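(* Let $R\in\mathcal{S}_1\cap B(H)_+$, fix $n\ge 1$, and let $(R^{(k)})_{k\ge 0}$, $(D_k)_{k\ge 1}$ be a depth $n$ HS greedy sequence starting from $R^{(0)}=R$. Then for every $k\ge 1$ for which $\Gamma_n(R^{(k-1)})$ is defined, $$\|R^{(k)}\|_2^2\le\left(1-\frac{1}{\Gamma_n(R^{(k-1)})N_n}\right)\|R^{(k-1)}\|_2^2.$$ In particular, since $\Gamma_n(R^{(k-1)})\le N_n$, one has for every $k\geq 1$ the uniform estimate $$\|R^{(k)}\|_2^2\le\left(1-\frac{1}{N_n^2}\right)^k\|R\|_2^2,$$ and therefore $R^{(k)}\to 0$ in $\mathcal{S}_2$. Moreover, $R=\sum_{k=1}^\infty D_k$ with convergence in $\mathcal{S}_2$, and for each $m\ge 1$ $$\Big\|R-\sum_{k=1}^mD_k\Big\|_2=\|R^{(m)}\|_2\le\left(1-\frac{1}{N_n^2}\right)^{m/2}\|R\|_2.$$ Finally, if $R^{(k-1)}$ is block diagonal at depth $n$, i.e. $\Gamma_n(R^{(k-1)})=1$, then $$\|R^{(k)}\|_2^2\le\left(1-\frac{1}{N_n}\right)\|R^{(k-1)}\|_2^2.$$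
   Context: $H$ is a Hilbert space and $B(H)_+$ is the set of bounded positive operators on $H$; $\mathcal{S}_1$ is the trace class and $\mathcal{S}_2$ the Hilbert-Schmidt (HS) class with norm $\|\cdot\|_2$. $\mathcal{T}$ is a rooted finitely branching tree with root $\emptyset$; $|w|$ denotes the depth of a node $w$ and $\mathrm{ch}(w)$ the finite set of children of $w$. $\{W_w\}_{w\in\mathcal{T}}$ is a family of closed subspaces of $H$ with orthogonal projections $P_w$ such that: for each $n\ge 0$, $H=\bigoplus_{|w|=n}W_w$ (orthogonal sum), so $I=\sum_{|w|=n}P_w$; and for each node $w$, $W_w=\bigoplus_{v\in\mathrm{ch}(w)}W_v$ (orthogonal sum), i.e. $P_w=\sum_{v\in\mathrm{ch}(w)}P_v$ with $P_vP_{v'}=0$ for distinct $v,v'\in\mathrm{ch}(w)$. For $A\in B(H)_+$, $C_w(A)=A^{1/2}P_wA^{1/2}$. $\mathcal{T}_n=\{w\in\mathcal{T}:|w|=n\}$ and $N_n=\#\mathcal{T}_n$. For $A\in\mathcal{S}_2\cap B(H)_+$, the depth $n$ coherence is $$\Gamma_n(A)=\frac{\|A\|_2^2}{\sum_{w\in\mathcal{T}_n}\|C_w(A)\|_2^2},$$ defined whenever the denominator is nonzero. $A$ is block diagonal at depth $n$ if $P_wA=AP_w$ for all $w\in\mathcal{T}_n$. A depth $n$ HS greedy sequence starting from $R$ is defined by $R^{(0)}=R$ and, for each $k\ge 1$: choose $w_k\in\mathcal{T}_n$ with $\|C_{w_k}(R^{(k-1)})\|_2=\max_{w\in\mathcal{T}_n}\|C_w(R^{(k-1)})\|_2$,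 and set $D_k=C_{w_k}(R^{(k-1)})$ and $R^{(k)}=R^{(k-1)}-D_k$. *)

(* Defs.v *)
(* MathComp-Analysis; the scalars are the complex numbers K[i] over K : realType. *)
From HB Require Import structures.
From mathcomp Require Import all_boot all_order all_algebra.
From mathcomp Require Import complex.
From mathcomp Require Import all_classical all_reals all_analysis.

Set Implicit Arguments.
Unset Strict Implicit.
Unset Printing Implicit Defensive.

Import Order.TTheory GRing.Theory Num.Theory.
Import numFieldNormedType.Exports.

Local Open Scope classical_set_scope.
Local Open Scope ring_scope.
Local Open Scope complex_scope.

(* The inner product is linear in its first argument.  The norm of a
   normed module over K[i] takes (real) values in K[i]. *)
Record hilbertSpace (K : realType) := HilbertSpace {
  hcarrier :> completeNormedModType K[i];
  hdot : {dot hcarrier for Num.conj};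
  hdot_norm : forall x : hcarrier, hdot x x = `|x| ^+ 2
}.

Notation "''[' u , v ]" := (hdot _ u v) : ring_scope.

Section Operators.
Context (K : realType) (H : hilbertSpace K).
Implicit Types (A B S : H -> H) (E V W : set H).

Definition bounded_op A : Prop :=
  linear A /\ exists M : K[i], forall x, `|A x| <= M * `|x|.

(* [0 <= z] in K[i] says that z is real and nonnegative. *)
Definition positive_op A : Prop :=
  bounded_op A /\ forall x, 0 <= '[A x, x].

(* The positive square root of a positive operator exists and is unique. *)
Definition sqrt_op A : H -> H :=
  xget (0 : H -> H) [set S | positive_op S /\ S \o S = A].

(* The adjoint of a bounded operator exists and is unique. *)
Definition adjoint A : H -> H :=
  xget (0 : H -> H) [set B | bounded_op B /\ forall x y, '[A x, y] = '[x, B y]].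

Definition abs_op A : H -> H := sqrt_op (adjoint A \o A).

Definition orthonormal_basis E : Prop :=
  (forall e f, E e -> E f -> '[e, f] = (e == f)%:R) /\
  (forall x, (forall e, E e -> '[x, e] = 0) -> x = 0).

(* Some orthonormal basis (one exists by Zorn); the trace and the
   Hilbert-Schmidt norm below do not depend on this choice.  H need not be
   separable, so the sums are taken over an arbitrary index set. *)
Definition onb : set H := xget set0 [set E | orthonormal_basis E].

(* Only meant for positive A, whose diagonal entries are real and >= 0. *)
Definition pos_trace A : \bar K :=
  (\esum_(e in onb) (complex.Re '[A e, e])%:E)%E.

Definition trace_class A : Prop :=
  bounded_op A /\ (pos_trace (abs_op A) < +oo)%E.

Definition hs_norm2 A : \bar K :=
  (\esum_(e in onb) (complex.Re `|A e| ^+ 2)%:E)%E.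

Definition hilbert_schmidt A : Prop :=
  bounded_op A /\ (hs_norm2 A < +oo)%E.

(* Only meaningful on Hilbert-Schmidt operators, as [fine +oo = 0]. *)
Definition hs_norm A : K := Num.sqrt (fine (hs_norm2 A)).

Definition cvg_hs (A_ : nat -> H -> H) A : Prop :=
  [/\ forall m, hilbert_schmidt (A_ m), hilbert_schmidt A &
      hs_norm (A_ m - A) @[m --> \oo] --> (0 : K)].

Definition closed_subspace W : Prop :=
  [/\ closed W, W 0 & forall (a : K[i]) x y, W x -> W y -> W (a *: x + y)].

Definition orth_proj W (P : H -> H) : Prop :=
  forall x, W (P x) /\ forall y, W y -> '[x - P x, y] = 0.

Definition orth_sum V (I : eqType) (s : seq I) (W : I -> set H) : Prop :=
  (forall i j, i \in s -> j \in s -> i != j ->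
     forall x y, W i x -> W j y -> '[x, y] = 0) /\
  V = [set \sum_(i <- s) y i
      | y in [set y : I -> H | forall i, i \in s -> W i (y i)]].

End Operators.

(* The last field says that every node is reached from the root. *)
Record rootedTree := RootedTree {
  node :> eqType;
  root : node;
  ch : node -> seq node;
  ch_uniq : forall w, uniq (ch w);
  root_notin_ch : forall w, root \notin ch w;
  ch_parent : forall v w w', v \in ch w -> v \in ch w' -> w = w';
  tree_ind : forall Q : node -> Prop,
    Q root -> (forall w v, Q w -> v \in ch w -> Q v) -> forall w, Q w
}.

(* The nodes of depth n, each listed once (see [level_uniq]). *)
Definition level (T : rootedTree) (n : nat) : seq T :=
  iter n (fun s => flatten [seq ch w | w <- s]) [:: root T].

Lemma level_uniq (T : rootedTree) n : uniq (level T n).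
Proof.
elim: n => [//|n]; rewrite /level /=; move: (iter _ _ _) => s.
elim: s => [//|w s IH] /= /andP[ws us].
rewrite cat_uniq ch_uniq IH // andbT /=; apply/hasPn => v /flattenP[l].
move=> /mapP[w' w's ->] vw'; apply/negP => vw.
by move: ws; rewrite (ch_parent vw vw') w's.
Qed.

Section Coherence.
Context (K : realType) (H : hilbertSpace K) (T : rootedTree).
Implicit Types (A R : H -> H).

Record tree_decomposition (W : T -> set H) (P : T -> H -> H) : Prop := {
  td_closed : forall w, closed_subspace (W w);
  td_proj : forall w, orth_proj (W w) (P w);
  td_level : forall n, orth_sum setT (level T n) W;
  td_ch : forall w, orth_sum (W w) (ch w) W
}.

Variable P : T -> H -> H.

Definition Cop (w : T) A : H -> H := sqrt_op A \o P w \o sqrt_op A.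

Definition level_energy n A : K :=
  \sum_(w <- level T n) hs_norm (Cop w A) ^+ 2.

(* [coherence] is meaningful only when [coherence_defined] holds. *)
Definition coherence_defined n A : Prop := level_energy n A != 0.

Definition coherence n A : K := hs_norm A ^+ 2 / level_energy n A.

Definition block_diagonal n A : Prop :=
  forall w, w \in level T n -> P w \o A = A \o P w.

(* [D 0] is irrelevant. *)
Definition hs_greedy n R (Rs D : nat -> H -> H) : Prop :=
  Rs 0 = R /\
  forall k, exists w : T,
    [/\ w \in level T n,
        forall v, v \in level T n ->
          hs_norm (Cop v (Rs k)) <= hs_norm (Cop w (Rs k)),
        D k.+1 = Cop w (Rs k) &
        Rs k.+1 = Rs k - D k.+1].

End Coherence.

(* Main.v *)
Require Import Defs.
From HB Require Import structures.
From mathcomp Require Import all_boot all_order all_algebra.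
From mathcomp Require Import complex.
From mathcomp Require Import all_classical all_reals all_analysis.
From mathcomp Require Import finmap ring lra.

Set Implicit Arguments.
Unset Strict Implicit.
Unset Printing Implicit Defensive.

Import Order.TTheory GRing.Theory Num.Theory.
Import numFieldNormedType.Exports.

Local Open Scope classical_set_scope.
Local Open Scope ring_scope.

(** The whole statement is a computation with the operator matrix
    [(P_i A P_j)] of a positive operator [A] with respect to a resolution of
    the identity [(P_i)]; below, [|A|] is the Hilbert-Schmidt norm.

    Since the Hilbert-Schmidt norm is invariant under adjoints, applying
    Pythagoras on the left and on the right gives
    [|A|^2 = sum_ij |P_i A P_j|^2] ([hs_sqr_blocks]).  With [X = P A^(1/2)]
    and its adjoint [Y], the compression [A^(1/2) P A^(1/2)] is [Y X], whereas
    [X Y = P A P]; cyclicity of the trace makes their Hilbert-Schmidt norms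
    equal ([hs2_gram], [hs2_compression]).  So the norm of a compression is
    that of a diagonal block, and three facts follow.
    - The denominator of the coherence, called the energy below, is the
      diagonal part of the sum, so the coherence is 1 exactly when the
      off-diagonal blocks vanish, that is, when [A] commutes with every [P_i]
      ([energy_eq_block_diagonal]).
    - For the resolution [1 = P + (1 - P)] the residual
      [A - A^(1/2) P A^(1/2) = A^(1/2) (1 - P) A^(1/2)] has the norm of the
      other diagonal block, so that
      [|A - C|^2 + |C|^2 <= |A|^2] for [C = A^(1/2) P A^(1/2)]
      ([hs_sqr_residual]).  A greedy choice removes at least the average
      energy ([greedy_step]).
    - [A] is the sum of its [N] compressions, so [|A|^2] is at most [N] times
      the energy, by Cauchy-Schwarz ([hs_sqr_le_energy]).
    Combining the last two, one step multiplies [|A|^2] by at most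
    [1 - 1 / N^2], and the residuals stay positive and of finite trace, which
    makes the iteration work.

    The operator theory that this rests on is developed first: the existence
    of an orthonormal basis and Parseval's identity ([parseval]), which gives
    the invariance under adjoints ([hs2_adjoint]), and the existence and
    uniqueness of positive square roots ([sqrt_exists], [sqrt_unique]).
    Uniqueness also shows that a positive operator is its own absolute value,
    so that it has a finite diagonal sum if it is trace class.

    Norms are handled as real numbers ([nrm]) and the geometry through the
    real part of the inner product ([rdot]). *)

(** * The real geometry of a complex Hilbert space *)

Section RealGeometry.
Context (K : realType) (H : hilbertSpace K).
Implicit Types (x y z : H) (A B S : H -> H).

Definition nrm x : K := complex.Re `|x|.
Definition rdot x y : K := complex.Re '[x, y].

Lemma normrE x : `|x| = (nrm x)%:C%C.
Proof. by rewrite /nrm RRe_real // ger0_real. Qed.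

Lemma nrm_ge0 x : 0 <= nrm x.
Proof. by rewrite -ler0c -normrE. Qed.

Lemma nrm0 : nrm 0 = 0.
Proof. by rewrite /nrm normr0. Qed.

Lemma nrm_eq0 x : nrm x = 0 -> x = 0.
Proof. by move=> x0; apply/normr0_eq0; rewrite normrE x0. Qed.

Lemma nrmN x : nrm (- x) = nrm x.
Proof. by rewrite /nrm normrN. Qed.

Lemma nrm_sub x y : nrm (x - y) = nrm (y - x).
Proof. by rewrite -nrmN opprB. Qed.

Lemma nrmD x y : nrm (x + y) <= nrm x + nrm y.
Proof. by rewrite -lecR rmorphD /= -!normrE ler_normD. Qed.

Lemma nrmZ (a : K[i]) x : nrm (a *: x) = complex.Re `|a| * nrm x.
Proof.
rewrite /nrm normrZ normrE; have : 0 <= `|a| by [].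
by case: `|a| => b c; rewrite lecE /= => /andP[/eqP -> _]; rewrite mul0r subr0.
Qed.

Lemma nrmZr (t : K) x : 0 <= t -> nrm (t%:C%C *: x) = t * nrm x.
Proof. by move=> t0; rewrite nrmZ ger0_norm ?ler0c. Qed.

Lemma dotC x y : '[x, y] = ('[y, x])^*%C.
Proof. by rewrite hermC expr0 mul1r. Qed.

Lemma dotxx x : '[x, x] = (nrm x ^+ 2)%:C%C.
Proof. by rewrite hdot_norm normrE -rmorphXn. Qed.

Lemma rdotxx x : rdot x x = nrm x ^+ 2.
Proof. by rewrite /rdot dotxx. Qed.

Lemma dot0l y : '[0 : H, y] = 0. Proof. exact: linear0l. Qed.
Lemma dot0r x : '[x, 0 : H] = 0. Proof. exact: linear0. Qed.
Lemma dotDl x y z : '[x + y, z] = '[x, z] + '[y, z].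
Proof. exact: linearDl. Qed.
Lemma dotDr x y z : '[z, x + y] = '[z, x] + '[z, y].
Proof. exact: linearD. Qed.
Lemma dotNl x z : '[- x, z] = - '[x, z].
Proof. by apply/eqP; rewrite -addr_eq0 -dotDl addNr dot0l. Qed.
Lemma dotNr x z : '[z, - x] = - '[z, x].
Proof. by apply/eqP; rewrite -addr_eq0 -dotDr addNr dot0r. Qed.
Lemma dotBl x y z : '[x - y, z] = '[x, z] - '[y, z].
Proof. by rewrite dotDl dotNl. Qed.
Lemma dotBr x y z : '[z, x - y] = '[z, x] - '[z, y].
Proof. by rewrite dotDr dotNr. Qed.
Lemma dotZl (a : K[i]) x y : '[a *: x, y] = a * '[x, y].
Proof. exact: linearZl_LR. Qed.
Lemma dotZr (a : K[i]) x y : '[x, a *: y] = a^*%C * '[x, y].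
Proof. exact: linearZ_LR. Qed.
Lemma dot_suml I (s : seq I) (F : I -> H) y :
  '[\sum_(i <- s) F i, y] = \sum_(i <- s) '[F i, y].
Proof.
elim: s => [|i s IH]; first by rewrite !big_nil dot0l.
by rewrite !big_cons dotDl IH.
Qed.

Lemma dot_eql x y : (forall z, '[x, z] = '[y, z]) -> x = y.
Proof.
move=> xy; apply/eqP; rewrite -subr_eq0; apply/eqP/nrm_eq0/eqP.
by rewrite -sqrf_eq0 -rdotxx /rdot dotBl xy subrr.
Qed.

Lemma rdotC x y : rdot x y = rdot y x.
Proof. by rewrite /rdot dotC; case: '[y, x]. Qed.

Lemma rdotDl x y z : rdot (x + y) z = rdot x z + rdot y z.
Proof. by rewrite /rdot dotDl raddfD. Qed.
Lemma rdotDr x y z : rdot z (x + y) = rdot z x + rdot z y.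
Proof. by rewrite /rdot dotDr raddfD. Qed.
Lemma rdotNl x z : rdot (- x) z = - rdot x z.
Proof. by rewrite /rdot dotNl raddfN. Qed.
Lemma rdotNr x z : rdot z (- x) = - rdot z x.
Proof. by rewrite /rdot dotNr raddfN. Qed.
Lemma rdotBl x y z : rdot (x - y) z = rdot x z - rdot y z.
Proof. by rewrite rdotDl rdotNl. Qed.
Lemma rdotBr x y z : rdot z (x - y) = rdot z x - rdot z y.
Proof. by rewrite rdotDr rdotNr. Qed.
Lemma rdotZl (t : K) x y : rdot (t%:C%C *: x) y = t * rdot x y.
Proof. by rewrite /rdot dotZl; case: '[x, y] => a b /=;
  rewrite mul0r subr0. Qed.
Lemma rdotZr (t : K) x y : rdot x (t%:C%C *: y) = t * rdot x y.
Proof. by rewrite rdotC rdotZl rdotC. Qed.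

Lemma nrmD_sqr x y :
  nrm (x + y) ^+ 2 = nrm x ^+ 2 + nrm y ^+ 2 + 2 * rdot x y.
Proof. rewrite -!rdotxx rdotDl !rdotDr (rdotC y x); ring. Qed.
Lemma nrmB_sqr x y :
  nrm (x - y) ^+ 2 = nrm x ^+ 2 + nrm y ^+ 2 - 2 * rdot x y.
Proof. by rewrite nrmD_sqr nrmN rdotNr; ring. Qed.

Lemma rdot_le x y : rdot x y <= nrm x * nrm y.
Proof.
have [x0|x0] := eqVneq (nrm x) 0.
  by rewrite x0 mul0r (nrm_eq0 x0) /rdot dot0l.
have [y0|y0] := eqVneq (nrm y) 0.
  by rewrite y0 mulr0 (nrm_eq0 y0) /rdot dot0r.
have p : 0 < nrm x * nrm y by rewrite mulr_gt0 // lt_def nrm_ge0 ?x0 ?y0.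
have := sqr_ge0 (nrm ((nrm y)%:C%C *: x - (nrm x)%:C%C *: y)).
rewrite nrmB_sqr !nrmZr ?nrm_ge0 // rdotZl rdotZr.
by move=> d0; rewrite -(ler_pM2l p); nra.
Qed.

(** Completeness in quantitative form: the distance to the limit inherits the
    rate of the Cauchy property, so limits can be used through real
    inequalities alone. *)
Lemma complete_rate (u : nat -> H) (c : nat -> K) :
    (forall j k, (k <= j)%N -> nrm (u j - u k) <= c k) ->
    (forall e : K, 0 < e -> exists k, c k < e) ->
  exists l, forall k, nrm (u k - l) <= c k.
Proof.
move=> ucauchy c0.
have /cauchy_cvgP/cvg_ex[l ul] : cauchy (u @ \oo).
  apply/cauchy_ballP => e e0.
  have eE : e = (complex.Re e)%:C%C by rewrite RRe_real // gtr0_real.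
  have [k ck] : exists k, c k < complex.Re e / 2.
    by apply: c0; rewrite divr_gt0 // -ltcR -eE.
  have near_k : (u @ \oo) (ball (u k) (e / 2)).
    exists k => // j /= kj; rewrite -ball_normE /=.
    rewrite distrC normrE eE [X in _ < _ / X](_ : _ = 2%:C%C); last first.
      by rewrite rmorphMn.
    by rewrite -fmorph_div ltcR (le_lt_trans _ ck) // ucauchy.
  exists (ball (u k) (e / 2), ball (u k) (e / 2)) => //= -[a b] /= [ua ub].
  exact: ball_splitr ua ub.
exists l => k; apply/ler_addgt0Pr => e e0.
have : \forall j \near \oo, `|l - u j| < (e%:C)%C.
  by move/cvgrPdist_lt : ul; apply; rewrite ltcR.
case=> m _ /(_ (maxn m k) (leq_maxl _ _)) /= mk.
have {}mk : nrm (l - u (maxn m k)) < e by rewrite -ltcR -normrE.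
rewrite (le_trans _ (lerD (ucauchy (maxn m k) k (leq_maxr _ _)) (ltW mk))) //.
rewrite [leRHS]addrC; apply: le_trans _ (nrmD _ _).
by rewrite addrA subrK nrm_sub.
Qed.

Lemma cvg0_small (u : nat -> K) : (u n @[n --> \oo] --> (0 : K))%classic ->
  forall e : K, 0 < e -> exists k, u k < e.
Proof.
move=> /cvgrPdist_lt u0 e /u0[k _ /(_ k (leqnn k))] /=.
by rewrite sub0r normrN => uk; exists k; rewrite (le_lt_trans (ler_norm _)).
Qed.

End RealGeometry.

(** * Orthonormal bases and Parseval's identity *)

Section Parseval.
Context (K : realType) (H : hilbertSpace K).
Implicit Types (x y : H) (z : K[i]).

Let subBB (u a b : H) : (a - u) - (b - u) = a - b.
Proof. by rewrite opprB addrA subrK. Qed.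

(** Zorn's lemma yields a maximal orthonormal set; a nonzero vector orthogonal
    to it could be normalized and added. *)
Lemma onb_basis : orthonormal_basis (@onb K H).
Proof.
apply: xgetPex.
pose orth (E : set H) := forall e f, E e -> E f -> '[e, f] = (e == f)%:R.
have [F Forth chainF|E [oE Emax]] := @Zorn_bigcup H orth.
  move=> e f [A FA Ae] [B FB Bf].
  have [AB|BA] := chainF _ _ FA FB.
    by apply: (Forth _ FB) => //; apply: AB.
  by apply: (Forth _ FA) => //; apply: BA.
exists E; split=> // x xE; apply: contrapT => x0.
have nx0 : nrm x != 0 by apply/eqP => /nrm_eq0.
pose u := ((nrm x)^-1)%:C%C *: x.
have uu : '[u, u] = 1.
  rewrite dotxx nrmZr ?invr_ge0 ?nrm_ge0 // mulVf //.
  by rewrite expr1n.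
have uE e : E e -> '[u, e] = 0 by move=> Ee; rewrite dotZl xE // mulr0.
have Eu e : E e -> '[e, u] = 0 by move=> Ee; rewrite dotC uE // conjc0.
have nEu : ~ E u by move=> /uE /eqP; rewrite uu oner_eq0.
apply: (Emax (E `|` [set u])).
  split; first by move=> y; left.
  by move=> /(_ u) ab; apply: nEu; apply: ab; right.
move=> e f [Ee|->] [Ef|->]; first exact: oE.
- by rewrite Eu //; case: eqP => // eu; case: nEu; rewrite -eu.
- by rewrite uE //; case: eqP => // ue; case: nEu; rewrite ue.
- by rewrite uu eqxx.
Qed.

Lemma onb_orth (e f : H) : @onb K H e -> @onb K H f -> '[e, f] = (e == f)%:R.
Proof. exact: (onb_basis.1). Qed.

Definition sqc (z : K[i]) : K := complex.Re `|z| ^+ 2.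

Lemma sqc_ge0 z : 0 <= sqc z. Proof. exact: sqr_ge0. Qed.

Lemma cnorm_le0 z : complex.Re `|z| <= 0 -> z = 0.
Proof.
move=> le0; apply/normr0_eq0/eqP.
by rewrite eq_le normr_ge0 andbT lecE le0 andbT ger0_Im.
Qed.

Lemma sqcJ z : sqc z^*%C = sqc z. Proof. by rewrite /sqc normcJ. Qed.

Lemma sqcE z : (sqc z)%:C%C = z * z^*%C.
Proof. by rewrite -sqr_normc -add_Re2_Im2 /sqc normc_def sqr_sqrtr ?addr_ge0
  ?sqr_ge0. Qed.

Lemma sqc_dot_le x (e : H) : @onb K H e -> sqc '[x, e] <= nrm x ^+ 2.
Proof.
move=> Ee; rewrite -subr_ge0.
suff -> : nrm x ^+ 2 - sqc '[x, e] = nrm (x - '[x, e] *: e) ^+ 2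
  by rewrite sqr_ge0.
apply: complexI; rewrite rmorphB /= sqcE -!dotxx dotBr dotZr.
have -> : '[x - '[x, e] *: e, e] = 0.
  by rewrite dotBl dotZl (onb_orth Ee Ee) eqxx mulr1 subrr.
by rewrite mulr0 subr0 dotBl dotZl (dotC e x).
Qed.

(** The component of [x] orthogonal to finitely many basis vectors. *)
Definition residual x (F : {fset H}) : H := x - \sum_(e <- F) '[x, e] *: e.

Lemma residual_orth x (F : {fset H}) (e : H) :
  [set` F] `<=` @onb K H -> e \in F -> '[residual x F, e] = 0.
Proof.
move=> FE eF; rewrite dotBl dot_suml (big_fsetD1 e) //= big_seq big1 => [|f].
  by rewrite dotZl (onb_orth (FE _ eF) (FE _ eF)) eqxx mulr1 addr0 subrr.
rewrite in_fsetD1 => /andP[fe fF]; rewrite dotZl (onb_orth (FE _ fF) (FE _ eF)).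
by rewrite (negPf fe) mulr0.
Qed.

(** The residual for [G] is orthogonal to the span of [G], in which the
    difference of the two residuals lies. *)
Lemma residual_pyth x (F G : {fset H}) :
    [set` G] `<=` @onb K H -> (F `<=` G)%fset ->
  nrm (residual x F) ^+ 2 =
  nrm (residual x G) ^+ 2 + nrm (residual x F - residual x G) ^+ 2.
Proof.
move=> GE FG; rewrite -{1}(subrK (residual x G) (residual x F)) [_ - _ +
  _]addrC (nrmD_sqr (residual x G)).
suff -> : rdot (residual x G) (residual x F - residual x G) = 0
  by rewrite mulr0 addr0.
rewrite {3}/residual {2}/residual opprB addrC addrA subrK rdotBr.
have rsum (L : {fset H}) : (L `<=` G)%fset ->
    rdot (residual x G) (\sum_(e <- L) '[x, e] *: e) = 0.
  move=> LG; rewrite rdotC /rdot dot_suml big_seq big1 // => e eL.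
  by rewrite dotZl (dotC e) (residual_orth _ GE) ?conjc0 ?mulr0 // (fsubsetP
    LG).
by rewrite !rsum ?subrr // fsubset_refl.
Qed.

Lemma residual_bessel x (F : {fset H}) : [set` F] `<=` @onb K H ->
  nrm (residual x F) ^+ 2 = nrm x ^+ 2 - \sum_(e <- F) sqc '[x, e].
Proof.
move=> FE; apply: complexI; rewrite -dotxx {2}/residual dotBr rmorphB /= -dotxx.
rewrite [X in _ - X](_ : _ = 0) ?subr0; last first.
  rewrite dotC dot_suml big_seq big1 ?conjc0 // => e eF.
  by rewrite dotZl (dotC e) residual_orth // conjc0 mulr0.
rewrite dotBl dot_suml rmorph_sum; congr (_ - _); apply: eq_bigr => e _.
by rewrite dotZl /= sqcE (dotC e x).
Qed.

(** Nearly minimal residuals form a Cauchy sequence, because the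
    squared distance between nested residuals is the difference of their
    squared norms; the limit is orthogonal to the whole basis, so it is 0. *)
Lemma residual_small x (d : K) : 0 < d ->
  exists2 F : {fset H}, [set` F] `<=` @onb K H & nrm (residual x F) ^+ 2 < d.
Proof.
move=> d0; apply: contrapT => nosmall.
(* [inf V] is the squared distance from [x] to the span of the basis. *)
pose V := [set nrm (residual x F) ^+ 2 | F in [set F :
  {fset H} | [set` F] `<=` @onb K H]].
have Vinf : has_inf V.
  split; first by exists (nrm (residual x fset0) ^+ 2); exists fset0.
  by exists 0 => _ [F _ <-]; rewrite sqr_ge0.
have lb F : [set` F] `<=` @onb K H -> inf V <= nrm (residual x F) ^+ 2.
  by move=> FE; apply: ge_inf; [exact: Vinf.2|exists F].
have /choice[F FP] : forall k : nat, exists F : {fset H},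
  [set` F] `<=` @onb K H /\
    nrm (residual x F) ^+ 2 < inf V + k.+1%:R^-1 ^+ 2.
  move=> k; have kp : 0 < (k.+1%:R^-1 ^+ 2 : K)
    by rewrite exprn_gt0 // invr_gt0.
  by have [_ [F FE <-] Flt] := inf_adherent kp Vinf; exists F.
have far k G : [set` G] `<=` @onb K H -> (F k `<=` G)%fset ->
    nrm (residual x (F k) - residual x G) <= k.+1%:R^-1.
  move=> GE FG; rewrite -(@ler_pXn2r _ 2) ?nnegrE ?nrm_ge0 ?invr_ge0 //.
  have := residual_pyth x GE FG; have := lb _ GE; have := (FP k).2.
  by move: (_^-1 ^+ 2) => c; lra.
have FUE j k : [set` (F j `|` F k)%fset] `<=` @onb K H.
  by move=> e /=; rewrite in_fsetU => /orP[]; apply: (FP _).1.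
have [l ul] : exists l, forall k, nrm (residual x (F k) - l) <= 2 * k.+1%:R^-1.
  apply: complete_rate => [j k kj|e e0].
    rewrite -(subBB (residual x (F j `|` F k)%fset)).
    apply: le_trans (nrmD _ _) _; rewrite nrmN mulrDl mul1r.
    apply: lerD; last by apply: far => //; exact: fsubsetUr.
    apply: (@le_trans _ _ j.+1%:R^-1); first by apply: far => //;
      exact: fsubsetUl.
    by rewrite lef_pV2 ?posrE // ler_nat.
  have [k] := @cvg0_small K _ cvg_harmonic (e / 2) (divr_gt0 e0 (ltr0Sn K 1)).
  by exists k; rewrite mulrC -ltr_pdivlMr.
have small (t : K) : (forall k : nat, t <= 3 * k.+1%:R^-1) -> t <= 0.
  move=> tk; rewrite leNgt; apply/negP => t0.
  have [k] := @cvg0_small K _ cvg_harmonic (t / 3) (divr_gt0 t0 (ltr0Sn K 2)).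
  by rewrite ltr_pdivlMr // mulrC ltNge tk.
have l0 : l = 0.
  apply: onb_basis.2 => e Ee.
  apply: cnorm_le0; apply: small => k; set G := (e |` F k)%fset.
  have GE : [set` G] `<=` @onb K H.
    by move=> f /=; rewrite in_fset1U => /orP[/eqP->//|]; apply: (FP _).1.
  have -> : '[l, e] = '[l - residual x G, e].
    by rewrite dotBl residual_orth ?subr0 // fset1U1.
  apply: le_trans (_ : nrm (l - residual x G) <= _).
    rewrite -(@ler_pXn2r _ 2) ?nnegrE ?nrm_ge0 //; first exact: sqc_dot_le.
    by rewrite normc_def sqrtr_ge0.
  rewrite nrm_sub -(subBB (residual x (F k))).
  apply: le_trans (nrmD _ _) _; rewrite nrmN (_ : 3 = 1 + 2) // mulrDl mul1r.
  by apply: lerD; rewrite nrm_sub ?ul //; apply: far => //; exact: fsubsetUr.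
have inf0 : inf V <= 0.
  have : Num.sqrt (inf V) <= 0.
    apply: small => k; apply: (@le_trans _ _ (nrm (residual x (F k)))).
      rewrite -[leRHS]ger0_norm ?nrm_ge0 // -sqrtr_sqr ler_wsqrtr // lb //.
      exact: (FP k).1.
    have := ul k; rewrite l0 subr0 => /le_trans; apply.
    by rewrite ler_wpM2r ?invr_ge0 // ler_nat.
  by move=> s0; rewrite -sqrtr_eq0 eq_le s0 sqrtr_ge0.
have [_ [F0 F0E <-] Flt] := inf_adherent d0 Vinf.
by apply: nosmall; exists F0 => //; lra.
Qed.

(** Every finite partial sum is at most [|x|^2] by Bessel, and the defect is
    the squared norm of a residual. *)
Lemma parseval x :
  (\esum_(e in @onb K H) (sqc '[x, e])%:E = (nrm x ^+ 2)%:E)%E.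
Proof.
have finE (F : {fset H}) :
    (\sum_(e \in [set` F]) (sqc '[x, e])%:E = (\sum_(e <- F) sqc '[x, e])%:E)%E.
  by rewrite fsbig_finite //= set_fsetK sumEFin.
apply/eqP; rewrite eq_le; apply/andP; split.
  apply: ge_ereal_sup => _ [X [finX XE] <-];
    rewrite -(fset_setK finX) finE lee_fin.
  by rewrite -subr_ge0 -residual_bessel ?sqr_ge0 // fset_setK.
apply/lee_addgt0Pr => d d0; have [F FE Fd] := residual_small x d0.
rewrite -leeBlDr // -EFinB; apply: esum_ge; exists [set` F]; first by split.
by rewrite finE lee_fin; move: Fd; rewrite residual_bessel //; lra.
Qed.

End Parseval.

(** * Adjoints and the Hilbert-Schmidt norm *)

Section HilbertSchmidt.
Context (K : realType) (H : hilbertSpace K).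
Implicit Types (A B X Y : H -> H).

(** Adjoints enter only through this relation, so that none has to be
    constructed; it already forces both operators to be linear. *)
Definition adjoint_pair A B := forall x y, '[A x, y] = '[x, B y].

Lemma adjoint_pair_sym A B : adjoint_pair A B -> adjoint_pair B A.
Proof. by move=> AB x y; rewrite dotC -AB -dotC. Qed.

Lemma adjoint_pair_comp A A' B B' :
  adjoint_pair A A' -> adjoint_pair B B' -> adjoint_pair (A \o B) (B' \o A').
Proof. by move=> AA BB x y /=; rewrite AA BB. Qed.

Lemma adjoint_pair_add A A' B B' : adjoint_pair A A' -> adjoint_pair B B' ->
  adjoint_pair (fun x => A x + B x) (fun x => A' x + B' x).
Proof. by move=> AA BB x y /=; rewrite dotDl dotDr AA BB. Qed.

Lemma adjoint_pair_unique A B B' :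
  adjoint_pair A B -> adjoint_pair A B' -> B =1 B'.
Proof. by move=> AB AB' y; apply: dot_eql => z; rewrite dotC -AB AB' -dotC. Qed.

Lemma adjoint_pair_linear A B : adjoint_pair A B -> linear A.
Proof.
by move=> AB a x y; apply: dot_eql => z; rewrite AB dotDl dotZl dotDl dotZl !AB.
Qed.

Lemma esum_swap (T1 T2 : choiceType) (I : set T1) (J : set T2)
    (a : T1 -> T2 -> \bar K) : (forall i j, I i -> J j -> (0 <= a i j)%E) ->
  (\esum_(i in I) \esum_(j in J) a i j = \esum_(j in J) \esum_(i in I) a i j)%E.
Proof.
move=> a0; rewrite !esum_esum //; last by move=> i j Ji Ij; apply: a0.
rewrite (reindex_esum (J `*`` (fun=> I)) _ (fun p => (p.2, p.1))) //=.
split=> [[j i] [/= ? ?]//|[j i] [j' i'] _ _ [-> ->]//|[i j] [/= ? ?]].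
by exists (j, i).
Qed.

Let sq_ge0 A x : (0 <= (nrm (A x) ^+ 2)%:E)%E.
Proof. by rewrite lee_fin sqr_ge0. Qed.

Lemma hs2_ge0 A : (0 <= hs_norm2 A)%E.
Proof. by apply: esum_ge0 => e _; exact: sq_ge0. Qed.

(** Both sides are the sum of the squared moduli of the matrix entries. *)
Lemma hs2_adjoint A B : adjoint_pair A B -> hs_norm2 A = hs_norm2 B.
Proof.
move=> AB; have entries C : (hs_norm2 C =
    \esum_(e in @onb K H) \esum_(f in @onb K H) (sqc '[C e, f])%:E)%E.
  by apply: eq_esum => e _; rewrite parseval.
rewrite !entries esum_swap => [|e f _ _]; last by rewrite lee_fin sqc_ge0.
by apply: eq_esum => f _; apply: eq_esum => e _; rewrite AB dotC sqcJ.
Qed.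

Lemma hs2_eq A B : (forall x, nrm (A x) = nrm (B x)) -> hs_norm2 A = hs_norm2 B.
Proof.
by move=> AB; apply: eq_esum => e _; congr ((_ ^+ 2)%:E); exact: AB.
Qed.

Lemma hs2_le A B :
  (forall x, nrm (A x) ^+ 2 <= nrm (B x) ^+ 2) -> (hs_norm2 A <= hs_norm2 B)%E.
Proof. by move=> AB; apply: le_esum => e _; rewrite lee_fin; exact: AB. Qed.

Lemma hs2_scale (M : K) A B : 0 <= M ->
    (forall x, nrm (A x) <= M * nrm (B x)) ->
  (hs_norm2 A <= (M ^+ 2)%:E * hs_norm2 B)%E.
Proof.
move=> M0 AB; apply: ge_ereal_sup => _ [F [finF FE] <-].
apply: (@le_trans _ _ ((M ^+ 2)%:E * \sum_(e \in F) (nrm (B e) ^+ 2)%:E)%E).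
  rewrite !fsbig_finite //= !sumEFin -EFinM lee_fin mulr_sumr.
  apply: ler_sum => e _; rewrite -exprMn.
  by apply: lerXn2r; rewrite ?nnegrE ?mulr_ge0 ?nrm_ge0 //; exact: AB.
apply: lee_wpmul2l; first by rewrite lee_fin sqr_ge0.
by apply: esum_ge; exists F.
Qed.

Let esum_sum_sqr (I : Type) (s : seq I) (B : I -> H -> H) :
  (\esum_(e in @onb K H) (\sum_(i <- s) nrm (B i e) ^+ 2)%:E =
   \sum_(i <- s) hs_norm2 (B i))%E.
Proof.
elim: s => [|i s IH]; first by rewrite big_nil esum1 // => e _; rewrite big_nil.
rewrite big_cons -IH -esumD => [|e _|e _]; last first.
- by rewrite lee_fin; apply: sumr_ge0 => i' _; exact: sqr_ge0.
- exact: sq_ge0.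
- by apply: eq_esum => e _; rewrite big_cons EFinD.
Qed.

Lemma hs2_sum (I : Type) (s : seq I) A (B : I -> H -> H) :
    (forall x, nrm (A x) ^+ 2 = \sum_(i <- s) nrm (B i x) ^+ 2) ->
  hs_norm2 A = (\sum_(i <- s) hs_norm2 (B i))%E.
Proof.
move=> AB; rewrite -esum_sum_sqr.
by apply: eq_esum => e _; congr (_%:E); exact: AB.
Qed.

Lemma hs2_sum_le (I : Type) (s : seq I) A (B : I -> H -> H) :
    (forall x, nrm (A x) ^+ 2 <= \sum_(i <- s) nrm (B i x) ^+ 2) ->
  (hs_norm2 A <= \sum_(i <- s) hs_norm2 (B i))%E.
Proof.
move=> AB; rewrite -esum_sum_sqr.
by apply: le_esum => e _; rewrite lee_fin; exact: AB.
Qed.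

(** [A] kills the basis, hence every value of its adjoint is orthogonal to
    the basis. *)
Lemma hs2_eq0 A B : adjoint_pair A B -> hs_norm2 A = 0%E -> forall x, A x = 0.
Proof.
move=> AB A0; have Ae e : onb e -> A e = 0.
  move=> Ee; apply/nrm_eq0/eqP; rewrite -sqrf_eq0 eq_le sqr_ge0 andbT.
  rewrite -lee_fin -[0%:E]A0; apply: esum_ge; exists [set e].
    by split; [exact: finite_set1|move=> _ ->].
  by rewrite fsbig_set1.
have B0 y : B y = 0.
  by apply: (onb_basis H).2 => e Ee; rewrite (adjoint_pair_sym AB) Ae // dot0r.
by move=> x; apply: dot_eql => z; rewrite AB B0 dot0l dot0r.
Qed.

(** The Hilbert-Schmidt form of the cyclicity of the trace,
    [tr ((Y X) (Y X)) = tr ((X Y) (X Y))] for [Y] the adjoint of [X].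
    The cross term in the expansion of [|X Y X + X|^2] is [2 |Y X|^2], and for
    the adjoint [Y X Y + Y] it is [2 |X Y|^2], so invariance of the norm under
    adjoints suffices. *)
Lemma hs2_gram X Y (M : K) : adjoint_pair X Y -> 0 <= M ->
    (forall x, nrm (X x) <= M * nrm x) -> (forall x, nrm (Y x) <= M * nrm x) ->
    (hs_norm2 X < +oo)%E ->
  hs_norm2 (Y \o X) = hs_norm2 (X \o Y).
Proof.
move=> XY M0 XM YM Xfin; have YX := adjoint_pair_sym XY.
have expand U V : adjoint_pair U V ->
    (hs_norm2 (fun x => U (V (U x)) + U x)%R =
     hs_norm2 (U \o V \o U) + hs_norm2 U +
     (hs_norm2 (V \o U) + hs_norm2 (V \o U)))%E.
  move=> UV; rewrite -!esumD;
    do ?[by move=> e _; rewrite ?adde_ge0 // lee_fin sqr_ge0].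
  apply: eq_esum => e _; rewrite -!EFinD; congr (_%:E).
  rewrite -[X in X ^+ 2]/(nrm _) nrmD_sqr /rdot UV -/(rdot _ _) rdotxx.
  by rewrite mulrDl mul1r.
have UVU : adjoint_pair (X \o Y \o X) (Y \o X \o Y).
  by move=> x y /=; rewrite XY YX XY.
have := hs2_adjoint (adjoint_pair_add UVU XY).
rewrite /= (expand _ _ XY) (expand _ _ YX) -(hs2_adjoint UVU) -(hs2_adjoint XY).
have fin (U V : H -> H) : (forall x, nrm (U x) <= M * nrm (V x)) ->
    (hs_norm2 V < +oo)%E -> (hs_norm2 U < +oo)%E.
  move=> UV Vfin; apply: (le_lt_trans (hs2_scale M0 UV)).
  by rewrite lte_mul_pinfty // lee_fin sqr_ge0.
have YXfin : (hs_norm2 (Y \o X) < +oo)%E by apply: fin Xfin => x; exact: YM.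
have XYXfin : (hs_norm2 (X \o Y \o X) < +oo)%E by apply: fin YXfin => x;
  exact: XM.
have XYfin : (hs_norm2 (X \o Y) < +oo)%E.
  by apply: (@fin _ Y) => [x|]; [exact: XM|rewrite -(hs2_adjoint XY)].
have finE (U : H -> H) : (hs_norm2 U < +oo)%E -> exists u, hs_norm2 U = u%:E.
  by move=> Ufin; exists (fine (hs_norm2 U));
    rewrite fineK ?ge0_fin_numE ?hs2_ge0.
have [a ->] := finE _ Xfin; have [b ->] := finE _ XYXfin.
have [c ->] := finE _ YXfin; have [d ->] := finE _ XYfin.
by rewrite -!EFinD => -[abcd]; congr (_%:E); lra.
Qed.

End HilbertSchmidt.

(** * Positive operators *)

Section PositiveOperators.
Context (K : realType) (H : hilbertSpace K).
Implicit Types (x y : H) (A B C D S T : H -> H) (M : K).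

(** The complex Cauchy-Schwarz inequality: rotate [x] so that the inner
    product becomes real. *)
Lemma dot_le x y : complex.Re `|'[x, y]| <= nrm x * nrm y.
Proof.
set r := complex.Re _; have r0 : 0 <= r by rewrite /r normc_def sqrtr_ge0.
have [->|rN0] := eqVneq r 0; first by rewrite mulr_ge0 ?nrm_ge0.
have rp : 0 < r by rewrite lt_def rN0.
rewrite -(ler_pM2l rp); have := rdot_le ('[x, y]^*%C *: x) y.
by rewrite /rdot dotZl mulrC -sqcE /= nrmZ normcJ -/r mulrA.
Qed.

Lemma bounded_opP A : bounded_op A <->
  linear A /\ exists2 M, 0 < M & forall x, nrm (A x) <= M * nrm x.
Proof.
split=> [[lA [M AM]]|[lA [M _ AM]]]; split=> //; last first.
  by exists M%:C%C => x; rewrite !normrE -rmorphM lecR.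
exists (`|complex.Re M| + 1) => [|x]; first by rewrite ltr_wpDl.
have := AM x; rewrite normrE (normrE x) lecE => /andP[_] /= /le_trans; apply.
case: M {AM} => a b /=; rewrite mulr0 subr0 mulrDl mul1r.
by apply: ler_wpDr; rewrite ?nrm_ge0 // ler_wpM2r ?nrm_ge0 // ler_norm.
Qed.

Lemma linear_sub A x y : linear A -> A (x - y) = A x - A y.
Proof. by move=> lA; rewrite -scaleN1r addrC lA addrC scaleN1r. Qed.

Lemma linear_zero A : linear A -> A 0 = 0.
Proof. by move=> lA; have := linear_sub 0 0 lA; rewrite !subrr. Qed.

Lemma linear_add A x y : linear A -> A (x + y) = A x + A y.
Proof. by move=> lA; have := lA 1 x y; rewrite !scale1r. Qed.

Lemma linear_scale A (a : K[i]) x : linear A -> A (a *: x) = a *: A x.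
Proof. by move=> lA; rewrite -[a *: x]addr0 lA linear_zero // addr0. Qed.

(** Polarization: on a complex space the form [<A x, y> - <x, A y>] is
    determined by its diagonal. *)
Lemma positive_symmetric A : positive_op A -> adjoint_pair A A.
Proof.
move=> [[lA _] A0] x y.
have s0 u : '[A u, u] = '[u, A u].
  by rewrite [RHS]dotC; move: (A0 u); rewrite lecE;
    case: '[A u, u] => a b /= /andP[/eqP ->]; rewrite oppr0.
have s1 := s0 (x + y); have s2 := s0 (x + 'i%C *: y).
move: s1 s2; rewrite !linear_add // linear_scale // !dotDl !dotDr !dotZl !dotZr
  (s0 x) (s0 y).
move: '[x, A x] '[y, A y] '[A x, y] '[x, A y] '[A y, x] '[y, A x].
move=> [? ?] [? ?] [a b] [a' b'] [c d] [c' d'] [e1 e2] [e3 e4].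
by apply/eqP; rewrite eq_complex /=; apply/andP; split; apply/eqP; lra.
Qed.

Lemma positive_rdot A x : positive_op A -> 0 <= rdot (A x) x.
Proof. by move=> [_ /(_ x)]; rewrite lecE => /andP[]. Qed.

Lemma positive_bound A : positive_op A ->
  exists2 M, 0 < M & forall x, nrm (A x) <= M * nrm x.
Proof. by move=> [/bounded_opP[]]. Qed.

Lemma positive_intro A M : adjoint_pair A A -> 0 <= M ->
  (forall x, nrm (A x) <= M * nrm x) -> (forall x, 0 <= rdot (A x) x) ->
  positive_op A.
Proof.
move=> AA M0 AM A0; split=> [|x].
  split; first exact: adjoint_pair_linear AA.
  by exists M%:C%C => x; rewrite !normrE -rmorphM lecR.
have : '[A x, x] = '[A x, x]^*%C by rewrite {1}AA dotC.
rewrite lecE; have := A0 x; rewrite /rdot; case: '[A x, x] => a b /= -> [bN].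
by rewrite andbT; apply/eqP; lra.
Qed.

(** Expanding [<A z, z> >= 0] at [z = M x - A x]. *)
Lemma positive_sqr_le A M x : positive_op A -> 0 < M ->
  (forall x, nrm (A x) <= M * nrm x) -> nrm (A x) ^+ 2 <= M * rdot (A x) x.
Proof.
move=> Apos M0 AM; have AA := positive_symmetric Apos.
have lA := adjoint_pair_linear AA.
have := positive_rdot (M%:C%C *: x - A x) Apos.
rewrite linear_sub // linear_scale // rdotBl !rdotBr !rdotZl !rdotZr rdotxx.
have -> : rdot (A (A x)) x = nrm (A x) ^+ 2
  by rewrite /rdot AA -/(rdot _ _) rdotxx.
have : rdot (A (A x)) (A x) <= M * nrm (A x) ^+ 2.
  apply: le_trans (rdot_le _ _) _; rewrite expr2 mulrA.
  by rewrite ler_wpM2r ?nrm_ge0.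
move=> h1 h2; rewrite -(ler_pM2l M0); nra.
Qed.

(** * The positive square root *)

(** The iteration [Y' = (C + Y^2) / 2] for the root [1 - Y] of [1 - C], and
    the same iteration in the reals with [C = 1], which dominates it. *)
Fixpoint root_iter C n : H -> H :=
  if n is m.+1 then fun x => (2^-1)%:C%C *:
    (C x + root_iter C m (root_iter C m x))
  else fun=> 0.

Fixpoint root_rate n : K := if n is m.+1 then (1 + root_rate m ^+ 2) / 2 else 0.

Lemma root_rate_itv n : 0 <= root_rate n <= 1.
Proof. by elim: n => [|n /= /andP[y0 y1]]; rewrite ?lexx ?ler01 //; nra. Qed.

Lemma root_rate_mono k j : (k <= j)%N -> root_rate k <= root_rate j.
Proof.
move=> /subnK <-; elim: (j - k)%N => // n; rewrite addSn => /le_trans; apply.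
rewrite /=; have := sqr_ge0 (1 - root_rate (n + k)); nra.
Qed.

(** The increments are [(1 - y)^2 / 2], which cannot stay above a positive
    constant in a bounded sequence. *)
Lemma root_rate_small (e : K) : 0 < e -> exists k, 1 - root_rate k < e.
Proof.
move=> e0; apply: contrapT => far.
have far' k : e <= 1 - root_rate k.
  by rewrite leNgt; apply/negP => lt; apply: far; exists k.
have grow k : k%:R * (e ^+ 2 / 2) <= root_rate k.
  elim: k => [|k IH]; first by rewrite mul0r.
  rewrite -natr1 mulrDl mul1r /=.
  have : e ^+ 2 <= (1 - root_rate k) ^+ 2.
    by rewrite lerXn2r ?nnegrE ?(le_trans (ltW e0)).
  move: (k%:R * _) IH => a IH; nra.
have p : 0 < e ^+ 2 / 2 by rewrite divr_gt0 ?exprn_gt0.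
have := grow (Num.bound (e ^+ 2 / 2)^-1);
  have /andP[_ y1] := root_rate_itv (Num.bound (e ^+ 2 / 2)^-1).
have : (e ^+ 2 / 2)^-1 < (Num.bound (e ^+ 2 / 2)^-1)%:R.
  by apply: archi_boundP; rewrite invr_ge0 ltW.
rewrite -(ltr_pM2r p) mulVf ?gt_eqF // => lt1 le1.
by have := lt_le_trans lt1 (le_trans le1 y1); rewrite ltxx.
Qed.

(** Every limit argument below ends with this: an estimate valid at each
    stage of the iteration holds in the limit. *)
Lemma root_rate_le0 (t s : K) :
  (forall k, t <= (1 - root_rate k) * s) -> t <= 0.
Proof.
move=> ts; rewrite leNgt; apply/negP => t0.
have s0 : 0 < s.
  rewrite ltNge; apply/negP => s0; have := ts 0%N.
  by rewrite subr0 mul1r; lra.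
have [k] := root_rate_small (divr_gt0 t0 s0).
by rewrite ltr_pdivlMr // ltNge ts.
Qed.

Section Contraction.
Variable C : H -> H.
Hypotheses (CC : adjoint_pair C C) (C1 : forall x, nrm (C x) <= nrm x).
Notation Y := (root_iter C).
Notation y_ := root_rate.

Let half0 : 0 <= (2^-1 : K). Proof. by []. Qed.

Lemma root_iter_symmetric n : adjoint_pair (Y n) (Y n).
Proof.
elim: n => [|n IH] x y /=; first by rewrite dot0l dot0r.
by rewrite dotZl dotZr dotDl dotDr CC !IH conjc_real.
Qed.

Lemma root_iter_sub n x y : Y n (x - y) = Y n x - Y n y.
Proof. exact/linear_sub/adjoint_pair_linear/root_iter_symmetric. Qed.

Lemma root_iter_le n x : nrm (Y n x) <= y_ n * nrm x.
Proof.
elim: n x => [|n IH] x /=; first by rewrite nrm0 mul0r.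
have /andP[y0 _] := root_rate_itv n.
have YY : nrm (Y n (Y n x)) <= y_ n * (y_ n * nrm x).
  by apply: le_trans (IH _) _; rewrite ler_wpM2l.
by rewrite nrmZr //; have := nrmD (C x) (Y n (Y n x)); have := C1 x; lra.
Qed.

(** The identity [Y'' - Y' = (Y' (Y' - Y) + (Y' - Y) Y) / 2] holds whether or
    not the operators commute. *)
Lemma root_iter_step n x :
  nrm (Y n.+1 x - Y n x) <= (y_ n.+1 - y_ n) * nrm x.
Proof.
elim: n x => [|n IH] x; first by rewrite /= subr0 addr0 nrmZr //; have := C1 x;
  lra.
have -> : Y n.+2 x - Y n.+1 x = (2^-1)%:C%C *:
    (Y n.+1 (Y n.+1 x - Y n x) + (Y n.+1 (Y n x) - Y n (Y n x))).
  rewrite root_iter_sub addrA subrK -[Y n.+2 x]/(_ *: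
    (C x + Y n.+1 (Y n.+1 x))).
  rewrite -[X in _ - X = _]/(_ *: (C x + Y n (Y n x))) -scalerBr.
  by rewrite opprD addrACA subrr add0r.
have /andP[y0 _] := root_rate_itv n; have /andP[y1 _] := root_rate_itv n.+1.
have d0 : 0 <= y_ n.+1 - y_ n by rewrite subr_ge0 root_rate_mono.
have h1 : nrm (Y n.+1 (Y n.+1 x - Y n x)) <=
  y_ n.+1 * ((y_ n.+1 - y_ n) * nrm x).
  by apply: le_trans (root_iter_le _ _) _; rewrite ler_wpM2l.
have h2 : nrm (Y n.+1 (Y n x) - Y n (Y n x)) <=
  (y_ n.+1 - y_ n) * (y_ n * nrm x).
  by apply: le_trans (IH _) _; rewrite ler_wpM2l // root_iter_le.
rewrite nrmZr //; apply: le_trans (ler_wpM2l half0 (nrmD _ _)) _.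
have -> : y_ n.+2 - y_ n.+1 = (y_ n.+1 ^+ 2 - y_ n ^+ 2) / 2.
  by rewrite -[y_ n.+2]/((1 + y_ n.+1 ^+ 2) / 2) {2}/root_rate -/root_rate;
    ring.
by move: h1 h2; lra.
Qed.

Lemma root_iter_cauchy k j x : (k <= j)%N ->
  nrm (Y j x - Y k x) <= (y_ j - y_ k) * nrm x.
Proof.
elim: j => [|j IH]; first by rewrite leqn0 => /eqP ->;
  rewrite !subrr nrm0 mul0r.
rewrite leq_eqVlt => /orP[/eqP -> |]; first by rewrite !subrr nrm0 mul0r.
rewrite ltnS => /IH {}IH; have := root_iter_step j x.
have := nrmD (Y j.+1 x - Y j x) (Y j x - Y k x); rewrite addrA subrK.
move: (Y j.+1) (y_ j.+1) => Y' y'; lra.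
Qed.

Lemma root_iter_lim : exists L : H -> H,
  forall x k, nrm (Y k x - L x) <= (1 - y_ k) * nrm x.
Proof.
suff /choice[L LP] : forall x, exists l, forall k,
    nrm (Y k x - l) <= (1 - y_ k) * nrm x.
  by exists L.
move=> x; apply: complete_rate => [j k kj|e e0].
  apply: le_trans (root_iter_cauchy _ kj) _; rewrite ler_wpM2r ?nrm_ge0 //.
  by rewrite lerD2r; case/andP: (root_rate_itv j).
have [x0|x0] := eqVneq (nrm x) 0; first by exists 0%N; rewrite x0 mulr0.
have xp : 0 < nrm x by rewrite lt_def x0 nrm_ge0.
have [k lt] := root_rate_small (divr_gt0 e0 xp).
by exists k; rewrite -ltr_pdivlMr.
Qed.

Let rearrange (a b c d e f : H) : f + c = a + a ->
  f + e - (b + b) = a - b + (a - b) - (c - d + (d - e)).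
Proof.
move=> fc; rewrite (addrACA a) -fc -opprD (addrA (c - d)) subrK opprB.
by rewrite [RHS]addrC addrA addrACA addNr addr0 (addrC e).
Qed.

(** The limit [L] of the iteration satisfies [2 L = C + L^2], which says that
    [1 - L] squares to [1 - C]; it is positive because [L] is a symmetric
    contraction.  Whatever commutes with [C] commutes with every iterate,
    hence with [L]. *)
Lemma sqrt_contraction : exists S, [/\ positive_op S,
  forall x, S (S x) = x - C x &
  forall D, bounded_op D -> (forall x, D (C x) = C (D x)) ->
    forall x, D (S x) = S (D x)].
Proof.
have [L LP] := root_iter_lim.
have LL : adjoint_pair L L.
  move=> x y; apply/eqP; rewrite -subr_eq0; apply/eqP.
  have step k : complex.Re `|'[L x, y] - '[x, L y]| <=
      (1 - y_ k) * (nrm x * nrm y + nrm x * nrm y).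
    have -> : '[L x, y] - '[x, L y] = '[L x - Y k x, y] + '[x, Y k y - L y].
      by rewrite dotBl dotBr root_iter_symmetric addrA subrK.
    apply: (@le_trans _ _ (complex.Re
      (`|'[L x - Y k x, y]| + `|'[x, Y k y - L y]|))).
      have : `|'[L x - Y k x, y] + '[x, Y k y - L y]| <=
          `|'[L x - Y k x, y]| + `|'[x, Y k y - L y]| by exact: ler_normD.
      by rewrite lecE => /andP[].
    rewrite raddfD /= mulrDr.
    apply: lerD; apply: le_trans (dot_le _ _) _.
      by rewrite mulrA ler_wpM2r ?nrm_ge0 // nrm_sub LP.
    by rewrite mulrCA ler_wpM2l ?nrm_ge0.
  by apply: cnorm_le0; exact: root_rate_le0 step.
have L1 x : nrm (L x) <= nrm x.
  have := nrmD (L x - Y 0%N x) (Y 0%N x); rewrite subrK nrm_sub /= nrm0.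
  by have := LP x 0%N; rewrite /= subr0 mul1r addr0 => /le_trans h /le_trans;
    apply; apply: h.
have Lsub u v : L (u - v) = L u - L v.
  by apply: linear_sub; exact: adjoint_pair_linear LL.
have near0 (u : H) (s : K) : (forall k, nrm u <= (1 - y_ k) * s) -> u = 0.
  by move=> us; apply/nrm_eq0/eqP; rewrite eq_le nrm_ge0 (root_rate_le0 us).
have fixL x : C x + L (L x) = L x + L x.
  apply/eqP; rewrite -subr_eq0; apply/eqP.
  apply: (@near0 _ (4 * nrm x)) => k.
  have YYE : C x + Y k (Y k x) = Y k.+1 x + Y k.+1 x.
    by rewrite /= -mulr2n -scaler_nat scalerA -(rmorph_nat (real_complex K))
      -rmorphM /= mulfV ?scale1r.
  rewrite (rearrange (L x) (Y k (L x)) (L (L x)) YYE) -root_iter_sub.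
  have h1 := LP x k.+1.
  have h2 : nrm (Y k (Y k x - L x)) <= (1 - y_ k) * nrm x.
    apply: le_trans (root_iter_le _ _) _; apply: le_trans _ (LP x k).
    by rewrite ler_piMl ?nrm_ge0 //; case/andP: (root_rate_itv k).
  have h3 : nrm (Y k (L x) - L (L x)) <= (1 - y_ k) * nrm x.
    apply: le_trans (LP _ _) _; rewrite ler_wpM2l ?L1 // subr_ge0.
    by case/andP: (root_rate_itv k).
  have h4 : (1 - y_ k.+1) * nrm x <= (1 - y_ k) * nrm x.
    by rewrite ler_wpM2r ?nrm_ge0 // lerD2l lerN2 root_rate_mono.
  have := nrmD (Y k.+1 x - L x + (Y k.+1 x - L x))
    (- (Y k (Y k x - L x) + (Y k (L x) - L (L x)))).
  have := nrmD (Y k.+1 x - L x) (Y k.+1 x - L x).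
  have := nrmD (Y k (Y k x - L x)) (Y k (L x) - L (L x)).
  rewrite nrmN; move: h1 h2 h3 h4; move: (Y k.+1 x) (y_ k.+1) => Y' y'; lra.
pose S x := x - L x.
have SS : adjoint_pair S S by move=> x y; rewrite dotBl dotBr LL.
exists S; split.
- apply: (@positive_intro _ 2) => // x; last first.
    rewrite rdotBl rdotxx subr_ge0 expr2; apply: le_trans (rdot_le _ _) _.
    by rewrite ler_wpM2r ?nrm_ge0.
  by have := nrmD x (- L x); rewrite nrmN; have := L1 x; rewrite /S; lra.
- move=> x; rewrite /S Lsub.
  have -> : L (L x) = L x + L x - C x by rewrite -fixL addrC addKr.
  have -> : L x - (L x + L x - C x) = C x - L x.
    by rewrite opprB addrCA opprD (addrA (L x)) subrr add0r.
  by rewrite opprB addrA subrK.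
- move=> D /bounded_opP[lD [M M0 DM]] DC x; rewrite /S linear_sub //;
  congr (_ - _).
  have DY k z : D (Y k z) = Y k (D z).
    elim: k z => [|k IH] z /=; first by rewrite linear_zero.
    by rewrite linear_scale // linear_add // DC !IH.
  apply/eqP; rewrite -subr_eq0; apply/eqP.
  apply: (@near0 _ (M * nrm x + nrm (D x))) => k.
  have -> : D (L x) - L (D x) = - D (Y k x - L x) + (Y k (D x) - L (D x)).
    by rewrite (linear_sub _ _ lD) opprB addrA DY subrK.
  apply: le_trans (nrmD _ _) _; rewrite nrmN mulrDr; apply: lerD => //.
  by apply: le_trans (DM _) _; rewrite mulrCA ler_wpM2l // ltW.
Qed.

End Contraction.

(** [A] is rescaled so that [1 - A / M] is a contraction. *)
Lemma sqrt_exists A : positive_op A -> exists S, [/\ positive_op S, S \o S = A &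
  forall D, bounded_op D -> (forall x, D (A x) = A (D x)) ->
    forall x, D (S x) = S (D x)].
Proof.
move=> Apos; have [M M0 AM] := positive_bound Apos.
have AA := positive_symmetric Apos; have lA := adjoint_pair_linear AA.
pose C x := x - (M^-1)%:C%C *: A x.
have CC : adjoint_pair C C.
  by move=> x y; rewrite dotBl dotBr dotZl dotZr AA conjc_real.
have Mi0 : 0 < M^-1 by rewrite invr_gt0.
have C1 x : nrm (C x) <= nrm x.
  rewrite -(@ler_pXn2r _ 2) ?nnegrE ?nrm_ge0 // nrmB_sqr nrmZr ?(ltW Mi0) //
    rdotZr.
  rewrite (rdotC x).
  have r0 := mulr_ge0 (ltW Mi0) (positive_rdot x Apos).
  have : M^-1 * (M^-1 * nrm (A x) ^+ 2) <= M^-1 * rdot (A x) x.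
    by rewrite ler_pM2l // ler_pdivrMl // positive_sqr_le.
  move: r0; rewrite exprMn; move: (M^-1) (rdot _ _) (nrm (A x)) => t r a.
  lra.
have [S [Spos SS Scomm]] := sqrt_contraction CC C1.
have lS := adjoint_pair_linear (positive_symmetric Spos).
have [B B0 SB] := positive_bound Spos.
have m0 : 0 <= Num.sqrt M by rewrite sqrtr_ge0.
pose Q x := (Num.sqrt M)%:C%C *: S x.
exists Q; split.
- apply: (@positive_intro _ (Num.sqrt M * B)) => [x y||x|x].
  + by rewrite dotZl dotZr (positive_symmetric Spos) conjc_real.
  + by rewrite mulr_ge0 // ltW.
  + by rewrite nrmZr // -mulrA ler_wpM2l.
  + by rewrite rdotZl mulr_ge0 // positive_rdot.
- apply/funext => x; rewrite /= /Q linear_scale // scalerA -rmorphM /= -expr2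
  sqr_sqrtr ?ltW //.
  by rewrite SS /C opprB addrC subrK scalerA -rmorphM /= mulfV ?gt_eqF //
    scale1r.
- move=> D Db DA x; have lD := Db.1; rewrite /Q linear_scale // Scomm // => z.
  by rewrite /C linear_sub // linear_scale // DA.
Qed.

(** With [y = (S - T) x] one has [(S + T) y = (S^2 - T^2) x = 0], so the
    nonnegative numbers [<S y, y>] and [<T y, y>] vanish; then [S y = T y = 0]
    and [|y|^2 = <x, (S - T) y> = 0]. *)
Lemma sqrt_commuting_unique S T : positive_op S -> positive_op T ->
  (forall x, S (T x) = T (S x)) -> S \o S = T \o T -> S = T.
Proof.
move=> Spos Tpos ST /funeqP SSTT.
have SS := positive_symmetric Spos; have TT := positive_symmetric Tpos.
have lS := adjoint_pair_linear SS; have lT := adjoint_pair_linear TT.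
apply/funext => x; set y := S x - T x.
have y0 : S y + T y = 0.
  rewrite /y (linear_sub _ _ lS) (linear_sub _ _ lT) ST addrA subrK; apply/eqP;
    rewrite subr_eq0; apply/eqP; exact: SSTT.
have kill U : positive_op U -> rdot (U y) y = 0 -> U y = 0.
  move=> Upos Uy0; have [M M0 UM] := positive_bound Upos.
  have := positive_sqr_le y Upos M0 UM; rewrite Uy0 mulr0 => le0.
  by apply/nrm_eq0/eqP; rewrite -sqrf_eq0 eq_le le0 sqr_ge0.
have sum0 : rdot (S y) y + rdot (T y) y = 0 by rewrite -rdotDl y0 /rdot dot0l.
have s0 := positive_rdot y Spos; have t0 := positive_rdot y Tpos.
have Sy : S y = 0 by apply: kill => //; lra.
have Ty : T y = 0 by apply: kill => //; lra.
apply/eqP; rewrite -subr_eq0; apply/eqP/nrm_eq0/eqP.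
by rewrite -sqrf_eq0 -rdotxx -/y /rdot {1}/y dotBl SS TT Sy Ty subrr.
Qed.

(** Both roots commute with their common square, hence with the root
    constructed above, which therefore equals each of them. *)
Lemma sqrt_unique S T :
  positive_op S -> positive_op T -> S \o S = T \o T -> S = T.
Proof.
move=> Spos Tpos SSTT.
have SSpos : positive_op (S \o S).
  have [M M0 SM] := positive_bound Spos; have SS := positive_symmetric Spos.
  apply: (@positive_intro _ (M * M)) => [|||x].
  - exact: adjoint_pair_comp.
  - by rewrite mulr_ge0 // ltW.
  - move=> x /=; apply: le_trans (SM _) _.
    by rewrite -mulrA ler_wpM2l // ltW.
  - by rewrite /rdot /= SS -/(rdot _ _) rdotxx sqr_ge0.
have [Q [Qpos QQ Qcomm]] := sqrt_exists SSpos.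
have eqQ U : positive_op U -> U \o U = S \o S -> U = Q.
  move=> Upos UU; apply: sqrt_commuting_unique => //; last by rewrite UU QQ.
  by apply: Qcomm; [case: Upos|rewrite -UU].
by rewrite (eqQ S) // (eqQ T).
Qed.

Lemma sqrt_opP A : positive_op A ->
  positive_op (sqrt_op A) /\ sqrt_op A \o sqrt_op A = A.
Proof.
move=> /sqrt_exists[S [Spos SS _]].
exact: (@xgetPex _ 0 [set S | positive_op S /\ S \o S = A])
  (ex_intro _ S (conj Spos SS)).
Qed.

Lemma abs_op_positive A : positive_op A -> abs_op A = A.
Proof.
move=> Apos; have AA := positive_symmetric Apos.
have adjA : adjoint A = A.
  apply: xget_unique => [|B [_ AB]]; first by split; [case: Apos|].
  exact/funext/(adjoint_pair_unique AB).
rewrite /abs_op adjA; apply: xget_unique => // S [Spos SS].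
exact: sqrt_unique.
Qed.

End PositiveOperators.

(** * Compressions of a positive operator *)

Section Compression.
Context (K : realType) (H : hilbertSpace K).
Implicit Types (x y : H) (A B P Q S : H -> H).

Definition projector P := adjoint_pair P P /\ forall x, P (P x) = P x.

Lemma projector_sqr P x : projector P -> rdot (P x) x = nrm (P x) ^+ 2.
Proof. by move=> [PP Pid]; rewrite -rdotxx /rdot -[in RHS]PP Pid. Qed.

Lemma projector_le P x : projector P -> nrm (P x) <= nrm x.
Proof.
move=> Pp; have := rdot_le (P x) x; rewrite projector_sqr // expr2.
have [->|Px0] := eqVneq (nrm (P x)) 0; first by rewrite nrm_ge0.
by rewrite ler_pM2l // lt_def Px0 nrm_ge0.
Qed.

Lemma projector_compl P : projector P -> projector (fun x => x - P x).
Proof.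
move=> [PP Pid]; split=> [x y|x]; first by rewrite dotBl dotBr PP.
by rewrite /= (linear_sub _ _ (adjoint_pair_linear PP)) Pid subrr subr0.
Qed.

(** The form that the trace class hypothesis takes on a positive operator,
    where [abs_op] acts trivially; compressions preserve it. *)
Definition pos_trace_class A := positive_op A /\ (pos_trace A < +oo)%E.

Lemma trace_class_pos A : trace_class A -> positive_op A -> pos_trace_class A.
Proof. by move=> [_]; move=> + Apos; rewrite abs_op_positive. Qed.

Lemma pos_traceE A : positive_op A -> pos_trace A = hs_norm2 (sqrt_op A).
Proof.
move=> Apos; have [Spos SS] := sqrt_opP Apos; apply: eq_esum => e _;
  congr (_%:E).
rewrite -{1}SS /= -[RHS]/(nrm (sqrt_op A e) ^+ 2) -rdotxx.
by rewrite /rdot (positive_symmetric Spos).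
Qed.

Lemma hs2_sqrt_fin A : pos_trace_class A -> (hs_norm2 (sqrt_op A) < +oo)%E.
Proof. by move=> [Apos]; rewrite pos_traceE. Qed.

(** [A = A^(1/2) A^(1/2)] is a bounded operator times a Hilbert-Schmidt one. *)
Lemma hs2_fin A : pos_trace_class A -> (hs_norm2 A < +oo)%E.
Proof.
move=> At; have [Apos _] := At; have [Spos SS] := sqrt_opP Apos.
have [M M0 SM] := positive_bound Spos; rewrite -SS.
have h : forall x, nrm ((sqrt_op A \o sqrt_op A) x) <= M * nrm (sqrt_op A x).
  by move=> x; apply: SM.
apply: le_lt_trans (hs2_scale (ltW M0) h) _.
by rewrite lte_mul_pinfty ?hs2_sqrt_fin // lee_fin sqr_ge0.
Qed.

Definition compression A P := sqrt_op A \o P \o sqrt_op A.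

Lemma compression_positive A P :
  pos_trace_class A -> projector P -> pos_trace_class (compression A P).
Proof.
move=> At Pp; have [Apos _] := At; have [Spos SS] := sqrt_opP Apos.
have [M M0 SM] := positive_bound Spos; have Ssym := positive_symmetric Spos.
have rdotE x : rdot (compression A P x) x = nrm (P (sqrt_op A x)) ^+ 2.
  by rewrite -projector_sqr // /rdot /= Ssym.
split.
  apply: (@positive_intro _ _ _ (M * M)) => [x y||x|x].
  - by rewrite /compression /= Ssym Pp.1 Ssym.
  - by rewrite mulr_ge0 // ltW.
  - apply: le_trans (SM _) _; rewrite -mulrA ler_pM2l //.
    exact: le_trans (projector_le _ Pp) (SM _).
  - by rewrite rdotE sqr_ge0.
apply: le_lt_trans (hs2_sqrt_fin At); apply: le_esum => e _.
rewrite lee_fin -[X in X <= _]/(rdot _ _) rdotE.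
by rewrite -[leRHS]/(nrm _ ^+ 2) lerXn2r ?nnegrE ?nrm_ge0 ?projector_le.
Qed.

Lemma compression_compl A P : positive_op A ->
  A - compression A P = compression A (fun x => x - P x).
Proof.
move=> Apos; have [Spos SS] := sqrt_opP Apos; apply/funext => x.
rewrite /compression /= (linear_sub _ _ (adjoint_pair_linear
  (positive_symmetric Spos))).
by have := congr1 (fun f => f x) SS => /= ->.
Qed.

(** The operators compared are [Y X] and [X Y] for [X = P A^(1/2)] and its
    adjoint [Y = A^(1/2) P]. *)
Lemma hs2_compression A P : pos_trace_class A -> projector P ->
  hs_norm2 (compression A P) = hs_norm2 (P \o A \o P).
Proof.
move=> At Pp; have [Apos _] := At; have [Spos SS] := sqrt_opP Apos.
have [M M0 SM] := positive_bound Spos; have Ssym := positive_symmetric Spos.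
have XY : adjoint_pair (P \o sqrt_op A) (sqrt_op A \o P).
  by apply: adjoint_pair_comp => //; exact: Pp.1.
transitivity (hs_norm2 ((sqrt_op A \o P) \o (P \o sqrt_op A))).
  by apply: hs2_eq => x; rewrite /compression /= Pp.2.
rewrite (@hs2_gram _ _ _ _ M XY (ltW M0)) => [|x|x|].
- by apply: hs2_eq => x /=; have := congr1 (fun f => f (P x)) SS => /= ->.
- exact: le_trans (projector_le _ Pp) (SM _).
- by apply: le_trans (SM _) _; rewrite ler_pM2l //= projector_le.
- apply: le_lt_trans (hs2_sqrt_fin At); apply: hs2_le => x /=.
  by rewrite lerXn2r ?nnegrE ?nrm_ge0 ?projector_le.
Qed.

(** * Block decompositions *)

Section Resolution.
Context (I : eqType) (s : seq I) (P : I -> H -> H).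

Record resolution : Prop := {
  res_uniq : uniq s;
  res_proj : forall i, i \in s -> projector (P i);
  res_orth : forall i j x, i \in s -> j \in s -> i != j -> P i (P j x) = 0;
  res_sum : forall x, \sum_(i <- s) P i x = x
}.

Hypothesis Pres : resolution.

Lemma resolution_pyth x : nrm x ^+ 2 = \sum_(i <- s) nrm (P i x) ^+ 2.
Proof.
rewrite -rdotxx -{1}(res_sum Pres x) /rdot dot_suml raddf_sum /= [LHS]big_seq
  [RHS]big_seq.
by apply: eq_bigr => i si; rewrite -projector_sqr //; exact: (res_proj Pres).
Qed.

Lemma hs2_resolution A : hs_norm2 A = (\sum_(i <- s) hs_norm2 (P i \o A))%E.
Proof.
by apply: hs2_sum => x; exact: resolution_pyth.
Qed.

Definition block A i j := P i \o A \o P j.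

(** Pythagoras splits the range; after passing to adjoints, it splits the
    domain. *)
Lemma hs2_blocks A : adjoint_pair A A ->
  hs_norm2 A = (\sum_(j <- s) \sum_(i <- s) hs_norm2 (block A i j))%E.
Proof.
move=> AA; rewrite hs2_resolution [LHS]big_seq [RHS]big_seq.
apply: eq_bigr => j sj.
have PA : adjoint_pair (P j \o A) (A \o P j).
  by apply: adjoint_pair_comp AA; exact: (res_proj Pres sj).1.
by rewrite (hs2_adjoint PA) hs2_resolution.
Qed.

End Resolution.
End Compression.

(** * Energy of a resolution of the identity *)

Section GreedyStep.
Context (K : realType) (H : hilbertSpace K).
Implicit Types (x y : H) (A B P Q S : H -> H).

(** Only meaningful on Hilbert-Schmidt operators, since [fine +oo = 0]. *)
Definition hs_sqr A : K := fine (hs_norm2 A).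

Lemma hs_sqrE A : hs_norm A ^+ 2 = hs_sqr A.
Proof. by rewrite sqr_sqrtr // fine_ge0 // hs2_ge0. Qed.

Lemma hs_sqr_ge0 A : 0 <= hs_sqr A.
Proof. by rewrite fine_ge0 // hs2_ge0. Qed.

Lemma hs_norm_ge0 A : 0 <= hs_norm A. Proof. exact: sqrtr_ge0. Qed.

Lemma hs_sqrK A : (hs_norm2 A < +oo)%E -> hs_norm2 A = (hs_sqr A)%:E.
Proof. by move=> Afin; rewrite /hs_sqr fineK // ge0_fin_numE ?hs2_ge0. Qed.

Lemma hs_norm_eq A B : (forall x, nrm (A x) = nrm (B x)) ->
  hs_norm A = hs_norm B.
Proof. by move=> AB; rewrite /hs_norm (hs2_eq AB). Qed.

Lemma hs2_block_fin A P Q : projector P -> projector Q -> adjoint_pair A A ->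
  (hs_norm2 A < +oo)%E -> (hs_norm2 (P \o A \o Q) < +oo)%E.
Proof.
move=> Pp Qp AA; apply: le_lt_trans.
have AQ : adjoint_pair (A \o Q) (Q \o A) by apply: adjoint_pair_comp AA Qp.1.
apply: (@le_trans _ _ (hs_norm2 (A \o Q))).
  by apply: hs2_le => x /=; rewrite lerXn2r ?nnegrE ?nrm_ge0 ?projector_le.
rewrite (hs2_adjoint AQ).
by apply: hs2_le => x /=; rewrite lerXn2r ?nnegrE ?nrm_ge0 ?projector_le.
Qed.

Lemma hs_sqr_compression A P : pos_trace_class A -> projector P ->
  hs_sqr (compression A P) = hs_sqr (P \o A \o P).
Proof. by move=> At Pp; rewrite /hs_sqr hs2_compression. Qed.

(** The variance of the [a i] is nonnegative. *)
Lemma sqr_sum_le (I : Type) (a : I -> K) (r : seq I) :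
  (\sum_(i <- r) a i) ^+ 2 <= (size r)%:R * \sum_(i <- r) a i ^+ 2.
Proof.
have [r0|r0] := eqVneq (size r) 0%N.
  by move: r0 => /size0nil ->; rewrite !big_nil mulr0 expr0n.
have n0 : 0 < (size r)%:R :> K by rewrite ltr0n lt0n.
set S := \sum_(i <- r) a i; set Q := \sum_(i <- r) _; set n := _%:R in n0 *.
have : 0 <= \sum_(i <- r) (a i - S / n) ^+ 2.
  by apply: sumr_ge0 => i _; exact: sqr_ge0.
have -> : \sum_(i <- r) (a i - S / n) ^+ 2 =
    Q - 2 * (S / n) * S + n * (S / n) ^+ 2.
  rewrite (eq_bigr (fun i => a i ^+ 2 - 2 * (S / n) * a i + (S / n) ^+ 2)).
    rewrite big_split /= sumrB -mulr_sumr big_const_seq count_predT iter_addr_0.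
    by rewrite -[_ *+ size r]mulr_natl.
  by move=> i _; ring.
move=> v0; rewrite -subr_ge0.
have -> : n * Q - S ^+ 2 = n * (Q - 2 * (S / n) * S + n * (S / n) ^+ 2).
  by field; rewrite gt_eqF.
by rewrite mulr_ge0 // ltW.
Qed.

Section Resolution.
Context (I : eqType) (s : seq I) (P : I -> H -> H).
Hypothesis Pres : resolution s P.

Lemma hs_sqr_blocks A : adjoint_pair A A -> (hs_norm2 A < +oo)%E ->
  hs_sqr A = \sum_(j <- s) \sum_(i <- s) hs_sqr (block P A i j).
Proof.
move=> AA Afin; apply: EFin_inj;
  rewrite -hs_sqrK // (hs2_blocks Pres AA) -sumEFin.
rewrite [LHS]big_seq [RHS]big_seq; apply: eq_bigr => j sj.
rewrite -sumEFin [LHS]big_seq [RHS]big_seq; apply: eq_bigr => i si.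
by rewrite hs_sqrK // hs2_block_fin //; exact: (res_proj Pres).
Qed.

(** The denominator of the coherence; by [energyE] it is the diagonal part of
    the block sum. *)
Definition energy A : K := \sum_(i <- s) hs_sqr (compression A (P i)).

Lemma energyE A : pos_trace_class A ->
  energy A = \sum_(i <- s) hs_sqr (block P A i i).
Proof.
move=> At; rewrite /energy big_seq [RHS]big_seq; apply: eq_bigr => i si.
by rewrite hs_sqr_compression //; exact: (res_proj Pres).
Qed.

Lemma energy_ge0 A : 0 <= energy A.
Proof. by apply: sumr_ge0 => i _; exact: hs_sqr_ge0. Qed.

Lemma energy_offdiag A : pos_trace_class A ->
  hs_sqr A = energy A +
    \sum_(j <- s) \sum_(i <- s | i != j) hs_sqr (block P A i j).
Proof.
move=> At; rewrite hs_sqr_blocks ?energyE ?hs2_fin //; last first.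
  exact: positive_symmetric At.1.
rewrite -big_split /= [LHS]big_seq [RHS]big_seq; apply: eq_bigr => j sj.
by rewrite (bigD1_seq j) //; exact: (res_uniq Pres).
Qed.

(** Equality means that the off-diagonal blocks vanish; then [P_i A] and
    [A P_i] both reduce to the block [P_i A P_i]. *)
Lemma energy_eq_block_diagonal A : pos_trace_class A ->
  energy A = hs_sqr A <-> (forall i, i \in s -> P i \o A = A \o P i).
Proof.
move=> At; have AA := positive_symmetric At.1;
  have lA := adjoint_pair_linear AA.
have sym i : i \in s -> adjoint_pair (P i) (P i) by move=> /(res_proj Pres)[].
have A_sum x : A x = \sum_(i <- s) A (P i x).
  rewrite -{1}(res_sum Pres x).
  elim: s => [|i r IH]; first by rewrite !big_nil linear_zero.
  by rewrite !big_cons (linear_add _ _ lA) IH.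
split=> [eq|comm].
- have off i j x : i \in s -> j \in s -> i != j -> block P A i j x = 0.
    move=> si sj ij.
    have blk : adjoint_pair (block P A i j) (block P A j i).
      by move=> y z; rewrite /block /= (sym i si) AA (sym j sj).
    have bfin : (hs_norm2 (block P A i j) < +oo)%E.
      by apply: hs2_block_fin (hs2_fin At) => //; exact: (res_proj Pres).
    apply: (hs2_eq0 blk); rewrite hs_sqrK //; congr (_%:E).
    have /eqP := energy_offdiag At; rewrite -eq addrC -subr_eq subrr eq_sym.
    rewrite psumr_eq0 => [|k _]; last by apply: sumr_ge0 => l _;
      exact: hs_sqr_ge0.
    move=> /allP/(_ j sj) /=; rewrite psumr_eq0 => [|l _];
      last exact: hs_sqr_ge0.
    by move=> /allP/(_ i si); rewrite ij => /eqP.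
  move=> i si; apply/funext => x /=.
  have -> : P i (A x) = block P A i i x.
    rewrite A_sum.
    have lP := adjoint_pair_linear (sym i si).
    have -> : P i (\sum_(j <- s) A (P j x)) = \sum_(j <- s) block P A i j x.
      elim: s => [|j r IH]; first by rewrite !big_nil linear_zero.
      by rewrite !big_cons (linear_add _ _ lP) IH.
    rewrite (bigD1_seq i) ?(res_uniq Pres) //= big_seq_cond big1 ?addr0 // => j.
    by move=> /andP[sj ji]; rewrite off // eq_sym.
  rewrite -[RHS](res_sum Pres) (bigD1_seq i) ?(res_uniq Pres) //= big_seq_cond.
  by rewrite big1 ?addr0 // => j /andP[sj ji]; exact: off.
- rewrite energy_offdiag // [X in _ = _ + X]big_seq big1 ?addr0 // => j sj.
  rewrite big_seq_cond big1 // => i /andP[si ij].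
  have -> : block P A i j = fun=> 0.
    apply/funext => x; rewrite /block /=.
    have /(congr1 (fun f => f (P j x))) /= -> := comm i si.
    by rewrite (res_orth Pres) // linear_zero.
  by rewrite /hs_sqr /hs_norm2 esum1 // => e _; rewrite normr0 /= expr0n.
Qed.

(** [A] is the sum of its compressions; Cauchy-Schwarz is applied to that sum
    at each vector. *)
Lemma hs_sqr_le_energy A : pos_trace_class A ->
  hs_sqr A <= (size s)%:R * energy A.
Proof.
move=> At; have [Spos SS] := sqrt_opP At.1.
have lS := adjoint_pair_linear (positive_symmetric Spos).
have A_sum x : A x = \sum_(i <- s) compression A (P i) x.
  rewrite -[in LHS]SS /= -{1}(res_sum Pres (sqrt_op A x)).
  elim: s => [|i r IH]; first by rewrite !big_nil linear_zero.
  by rewrite !big_cons (linear_add _ _ lS) IH.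
pose m := Num.sqrt (size s)%:R : K.
have m2 : m ^+ 2 = (size s)%:R by rewrite sqr_sqrtr.
pose B i := fun x => m%:C%C *: compression A (P i) x.
have Bfin i : i \in s -> (hs_norm2 (B i) <=
  ((size s)%:R * hs_sqr (compression A (P i)))%:E)%E.
  move=> si; rewrite EFinM -m2 -hs_sqrK; last first.
    exact: hs2_fin (compression_positive At (res_proj Pres si)).
  by apply: hs2_scale => [|x]; rewrite ?sqrtr_ge0 // nrmZr ?sqrtr_ge0.
rewrite -lee_fin -hs_sqrK ?hs2_fin //.
apply: (@le_trans _ _ (\sum_(i <- s) hs_norm2 (B i))%E).
  apply: hs2_sum_le => x.
  have -> : \sum_(i <- s) nrm (B i x) ^+ 2 =
      (size s)%:R * \sum_(i <- s) nrm (compression A (P i) x) ^+ 2.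
    by rewrite mulr_sumr; apply: eq_bigr => i _;
      rewrite nrmZr ?sqrtr_ge0 // exprMn m2.
  apply: le_trans _ (sqr_sum_le _ _); rewrite A_sum lerXn2r ?nnegrE ?nrm_ge0 //.
    by apply: sumr_ge0 => i _; exact: nrm_ge0.
  elim: s => [|i r IH]; first by rewrite !big_nil nrm0.
  by rewrite !big_cons; apply: le_trans (nrmD _ _) _; rewrite lerD2l.
rewrite /energy mulr_sumr -sumEFin big_seq [leRHS]big_seq.
by apply: lee_sum => i; exact: Bfin.
Qed.

End Resolution.

(** In the splitting [1 = P + (1 - P)] the residual and the removed part have
    the norms of the two diagonal blocks of [A]. *)
Lemma hs_sqr_residual A P : pos_trace_class A -> projector P ->
  hs_sqr (A - compression A P) + hs_sqr (compression A P) <= hs_sqr A.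
Proof.
move=> At Pp; have AA := positive_symmetric At.1.
have lP := adjoint_pair_linear Pp.1.
pose Q (b : bool) := if b then P else fun x => x - P x.
have Qres : resolution [:: true; false] Q.
  split=> //.
  - by move=> [] _ //; exact: projector_compl.
  - move=> [] [] x _ _ //= _; last by rewrite Pp.2 subrr.
    by rewrite (linear_sub _ _ lP) Pp.2 subrr.
  - by move=> x; rewrite !big_cons big_nil addr0 /= addrC subrK.
rewrite (compression_compl _ At.1) (hs_sqr_compression At (projector_compl Pp)).
rewrite (hs_sqr_compression At Pp) (hs_sqr_blocks Qres AA (hs2_fin At)).
rewrite !big_cons !big_nil !addr0 /block /=.
have := hs_sqr_ge0 (P \o A \o Q false); have := hs_sqr_ge0 (Q false \o A \o P).
by rewrite /Q /=; lra.
Qed.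

End GreedyStep.

(** * Projections of a tree decomposition *)

Section TreeProjections.
Context (K : realType) (H : hilbertSpace K) (T : rootedTree).

Lemma orth_proj_projector (W : set H) P : orth_proj W P -> projector P.
Proof.
move=> WP; have dotP x y : '[P x, y] = '[P x, P y].
  apply/eqP; rewrite -subr_eq0 -dotBr dotC (WP y).2 ?conjc0 //; exact: (WP x).1.
have PP : adjoint_pair P P.
  by move=> x y; rewrite dotP dotC -dotP -dotC.
by split=> // x; apply: dot_eql => y; rewrite [LHS]PP -dotP.
Qed.

(** [x - sum_v P_v x] is orthogonal to each summand [W_w], hence to the whole
    space. *)
Lemma tree_resolution (W : T -> set H) (P : T -> H -> H) n :
  tree_decomposition W P -> resolution (level T n) P.
Proof.
move=> WP; have proj w := orth_proj_projector (td_proj WP w).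
have [orthW sumW] := td_level WP n.
have orthP v w x y : v \in level T n -> w \in level T n -> v != w ->
    '[P v x, P w y] = 0.
  move=> sv sw vw; apply: (orthW v w) => //; first exact: (td_proj WP v x).1.
  exact: (td_proj WP w y).1.
split=> //.
- exact: level_uniq.
- move=> v w x sv sw vw; apply: dot_eql => y; rewrite (proj v).1 dot0l.
  by rewrite orthP // eq_sym.
- move=> x; apply: dot_eql => z.
  have : [set: H] z by [].
  rewrite sumW => -[y Wy <-]; rewrite dotC [RHS]dotC; congr (_ ^*%C).
  rewrite !dot_suml big_seq [RHS]big_seq; apply: eq_bigr => w sw.
  rewrite dotC [RHS]dotC; congr (_ ^*%C);
    rewrite dot_suml (bigD1_seq w) ?level_uniq //=.
  rewrite big_seq_cond big1 ?addr0 => [|v /andP[sv vw]].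
    by apply/eqP; rewrite eq_sym -subr_eq0 -dotBl (td_proj WP w x).2 //;
      exact: Wy.
  by apply: (orthW v w) => //; [exact: (td_proj WP v x).1|exact: Wy].
Qed.

End TreeProjections.

(** * The greedy iteration *)

Section Iteration.
Context (K : realType) (H : hilbertSpace K).
Implicit Types (x y : H) (A B P : H -> H).

Lemma pos_trace_class_hs A : pos_trace_class A -> hilbert_schmidt A.
Proof. by move=> At; split; [exact: At.1.1|exact: hs2_fin]. Qed.

Lemma hilbert_schmidt0 : hilbert_schmidt (0 : H -> H).
Proof.
split; last by rewrite /hs_norm2 esum1 // => e _; rewrite normr0 /= expr0n.
split; first by move=> a x y; rewrite scaler0 addr0.
by exists 0 => x; rewrite normr0 mul0r.
Qed.

Lemma hilbert_schmidt_sub A B :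
  hilbert_schmidt A -> hilbert_schmidt B -> hilbert_schmidt (A - B).
Proof.
move=> [/bounded_opP[lA [M M0 AM]] Afin] [/bounded_opP[lB [N N0 BN]] Bfin].
split.
  apply/bounded_opP; split=> [a x y|].
    by rewrite -[LHS]/(A _ - B _) lA lB scalerBr addrACA opprD.
  exists (M + N) => [|x]; first exact: addr_gt0.
  apply: le_trans (nrmD _ _) _; rewrite nrmN mulrDl.
  exact: lerD.
apply: (@le_lt_trans _ _ (hs_norm2 A + hs_norm2 A + (hs_norm2 B + hs_norm2
  B))%E).
  (* [|a - b|^2 <= 2 |a|^2 + 2 |b|^2], as a sum of four squares. *)
  pose F (i : 'I_4) := if (i < 2)%N then A else B.
  have -> : (hs_norm2 A + hs_norm2 A + (hs_norm2 B + hs_norm2 B) =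
      \sum_(i < 4) hs_norm2 (F i))%E.
    by rewrite !big_ord_recl big_ord0 adde0 /F /= !addeA.
  apply: hs2_sum_le => x; rewrite !big_ord_recl big_ord0 addr0 /F /=.
  have := sqr_ge0 (nrm (A x + B x)); rewrite nrmD_sqr.
  rewrite -[(A - B) x]/(A x - B x) nrmB_sqr; lra.
by rewrite !lte_add_pinfty.
Qed.

Lemma compression_residual A P :
  pos_trace_class A -> projector P -> pos_trace_class (A - compression A P).
Proof.
move=> At Pp; rewrite (compression_compl _ At.1).
exact: compression_positive At (projector_compl Pp).
Qed.

(** The chosen compression carries at least the average energy. *)
Lemma greedy_step (I : eqType) (s : seq I) (P : I -> H -> H) A i :
    resolution s P -> pos_trace_class A -> i \in s ->
    (forall j, j \in s -> hs_norm (compression A (P j)) <=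
      hs_norm (compression A (P i))) ->
  hs_sqr (A - compression A (P i)) <= hs_sqr A - energy s P A / (size s)%:R.
Proof.
move=> Pres At si imax.
have n0 : 0 < (size s)%:R :> K by rewrite ltr0n; case: (s) si.
apply: (@le_trans _ _ (hs_sqr A - hs_sqr (compression A (P i)))).
  by rewrite lerBrDr; apply: hs_sqr_residual; rewrite //;
    exact: (res_proj Pres).
rewrite lerD2l lerN2 ler_pdivrMr // mulrC -sum1_size natr_sum mulr_suml.
rewrite /energy big_seq [leRHS]big_seq; apply: ler_sum => j sj.
by rewrite mul1r -!hs_sqrE lerXn2r ?nnegrE ?hs_norm_ge0 ?imax.
Qed.

Lemma cvg_hs_geometric (A_ : nat -> H -> H) A (q c : K) : 0 <= q < 1 -> 0 <=
  c ->
    (forall m, hilbert_schmidt (A_ m)) -> hilbert_schmidt A ->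
    (forall m, hs_norm (A_ m - A) ^+ 2 <= q ^+ m * c ^+ 2) ->
  cvg_hs A_ A.
Proof.
move=> /andP[q0 q1] c0 A_hs Ahs bound; split=> //.
have r1 : Num.sqrt q < 1 by rewrite -[ltRHS]sqrtr1 ltr_sqrt.
have lim : (c * Num.sqrt q ^+ m @[m --> \oo] --> (0 : K))%classic.
  by apply: cvg_geometric; rewrite ger0_norm ?sqrtr_ge0.
apply: (squeeze_cvgr _ (cvg_cst 0) lim); near=> m.
rewrite hs_norm_ge0 /= -(@ler_pXn2r _ 2) ?nnegrE ?hs_norm_ge0 //; last first.
  by rewrite mulr_ge0 // exprn_ge0 ?sqrtr_ge0.
by apply: le_trans (bound m) _;
  rewrite exprMn -exprM mulnC exprM sqr_sqrtr // mulrC.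
Unshelve. all: by end_near.
Qed.

End Iteration.

Theorem theorem5p3 (K : realType) (H : hilbertSpace K) (T : rootedTree)
    (W : T -> set H) (P : T -> H -> H) (hW : tree_decomposition W P)
    (R : H -> H) (R_tc : trace_class R) (R_pos : positive_op R)
    (n : nat) (n_ge1 : (1 <= n)%N)
    (Rs D : nat -> H -> H) (hgreedy : hs_greedy P n R Rs D) :
  let N : K := (size (level T n))%:R in
  (* all the residuals lie in the domain of the coherence *)
  (forall k : nat, positive_op (Rs k) /\ hilbert_schmidt (Rs k)) /\
  (forall k : nat, (1 <= k)%N -> coherence_defined P n (Rs k.-1) ->
     coherence P n (Rs k.-1) <= N /\
     hs_norm (Rs k) ^+ 2 <=
       (1 - 1 / (coherence P n (Rs k.-1) * N)) * hs_norm (Rs k.-1) ^+ 2) /\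
  (forall k : nat, (1 <= k)%N ->
     hs_norm (Rs k) ^+ 2 <= (1 - 1 / N ^+ 2) ^+ k * hs_norm R ^+ 2) /\
  cvg_hs Rs 0 /\
  cvg_hs (fun m : nat => \sum_(1 <= k < m.+1) D k) R /\
  (forall m : nat, (1 <= m)%N ->
     hs_norm (R - \sum_(1 <= k < m.+1) D k) = hs_norm (Rs m) /\
     hs_norm (Rs m) <= (1 - 1 / N ^+ 2) `^ (m%:R / 2) * hs_norm R) /\
  (forall k : nat, (1 <= k)%N -> coherence_defined P n (Rs k.-1) ->
     (block_diagonal P n (Rs k.-1) <-> coherence P n (Rs k.-1) = 1)) /\
  (forall k : nat, (1 <= k)%N -> block_diagonal P n (Rs k.-1) ->
     hs_norm (Rs k) ^+ 2 <= (1 - 1 / N) * hs_norm (Rs k.-1) ^+ 2).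
Proof.
set s := level T n; move=> N.
have Pres : resolution s P := tree_resolution n hW.
have levelE A : level_energy P n A = energy s P A.
  by apply: eq_bigr => w _; exact: hs_sqrE.
have [Rs0 step] := hgreedy.
have Rst k : pos_trace_class (Rs k).
  elim: k => [|k IH]; first by rewrite Rs0; exact: trace_class_pos.
  have [w [sw _ -> ->]] := step k.
  by apply: compression_residual => //; exact: (res_proj Pres).
have N1 : 1 <= N.
  by have [w [sw _ _ _]] := step 0%N; rewrite /N ler1n /s; case: (level T n) sw.
have N0 : 0 < N by apply: lt_le_trans N1.
have decr k : hs_sqr (Rs k.+1) <= hs_sqr (Rs k) - energy s P (Rs k) / N.
  have [w [sw wmax Dk ->]] := step k; rewrite Dk.
  exact: greedy_step.
have energy_ge k : hs_sqr (Rs k) <= N * energy s P (Rs k).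
  exact: hs_sqr_le_energy.
pose q := 1 - 1 / N ^+ 2.
have q01 : 0 <= q < 1.
  have N2 : 0 < N ^+ 2 by rewrite exprn_gt0.
  apply/andP; split; last by rewrite ltrBlDr ltrDl divr_gt0.
  by rewrite subr_ge0 ler_pdivrMr // mul1r exprn_ege1.
have geom k : hs_sqr (Rs k) <= q ^+ k * hs_sqr R.
  elim: k => [|k IH]; first by rewrite Rs0 expr0 mul1r.
  apply: le_trans (decr k) _; rewrite exprS -mulrA.
  apply: le_trans (ler_wpM2l (proj1 (andP q01)) IH).
  have -> : q * hs_sqr (Rs k) = hs_sqr (Rs k) - hs_sqr (Rs k) / N / N.
    by rewrite /q; field; rewrite gt_eqF.
  by rewrite lerD2l lerN2 ler_pM2r ?invr_gt0 // ler_pdivrMr // mulrC.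
have partial m : \sum_(1 <= k < m.+1) D k = R - Rs m.
  elim: m => [|m IH]; first by rewrite big_geq // Rs0 subrr.
  have [w [_ _ _ ->]] := step m.
  by rewrite big_nat_recr //= IH opprB addrA addrAC.
have rate k : coherence_defined P n (Rs k) ->
    coherence P n (Rs k) <= N /\
    hs_sqr (Rs k.+1) <= (1 - 1 / (coherence P n (Rs k) * N)) * hs_sqr (Rs k).
  rewrite /coherence_defined /coherence levelE hs_sqrE => E0.
  have Ep : 0 < energy s P (Rs k) by rewrite lt_def E0 energy_ge0.
  split; first by rewrite ler_pdivrMr.
  have [h0|h0] := eqVneq (hs_sqr (Rs k)) 0.
    rewrite h0 mulr0; apply: le_trans (decr k) _; rewrite h0 sub0r oppr_le0.
    by rewrite divr_ge0 ?ltW.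
  suff -> : (1 - 1 / (hs_sqr (Rs k) / energy s P (Rs k) * N)) * hs_sqr (Rs k) =
      hs_sqr (Rs k) - energy s P (Rs k) / N by exact: decr.
  by field; rewrite h0 E0 gt_eqF.
have coh1 k : coherence_defined P n (Rs k) ->
    (block_diagonal P n (Rs k) <-> coherence P n (Rs k) = 1).
  rewrite /coherence_defined /coherence levelE hs_sqrE => E0.
  rewrite /block_diagonal -(energy_eq_block_diagonal Pres (Rst k)).
  by split=> [<-|e1]; [rewrite divff|rewrite -[LHS]mul1r -e1 divfK].
split; first by move=> k; split; [exact: (Rst k).1|exact: pos_trace_class_hs].
split.
  by move=> [//|k] _ /= /rate; rewrite !hs_sqrE.
split; first by move=> k _; rewrite !hs_sqrE.
split.
  apply: (cvg_hs_geometric q01 (hs_norm_ge0 R)) => [m||m].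
  - exact: pos_trace_class_hs.
  - exact: hilbert_schmidt0.
  - by rewrite subr0 !hs_sqrE.
split.
  apply: (cvg_hs_geometric q01 (hs_norm_ge0 R)) => [m||m].
  - by rewrite partial; apply: hilbert_schmidt_sub; rewrite -?Rs0;
    exact: pos_trace_class_hs.
  - by rewrite -Rs0; exact: pos_trace_class_hs.
  - rewrite partial addrAC subrr add0r (@hs_norm_eq _ _ _ (Rs m)) ?hs_sqrE //.
    by move=> x; exact: nrmN.
split.
  move=> m m1; split; first by rewrite partial opprB addrC subrK.
  rewrite -(@ler_pXn2r _ 2) ?nnegrE ?hs_norm_ge0 ?mulr_ge0 ?powR_ge0
    ?hs_norm_ge0 //.
  have [q0 _] := andP q01.
  by rewrite exprMn -[X in _ <=
    X * _]powR_mulrn ?powR_ge0 // -powRrM divfK // powR_mulrn // !hs_sqrE.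
split; first by move=> [//|k] _ /=; exact: coh1.
move=> [//|k] _ /= diag; rewrite !hs_sqrE.
(* Where the coherence is undefined, the residual is already zero. *)
have [E0|E0] := eqVneq (energy s P (Rs k)) 0.
  have h0 : hs_sqr (Rs k) = 0.
    by apply/eqP; rewrite eq_le hs_sqr_ge0 (le_trans (energy_ge k)) ?E0 ?mulr0.
  by rewrite h0 mulr0; have := decr k; rewrite h0 E0 mul0r subr0.
have def : coherence_defined P n (Rs k) by rewrite /coherence_defined levelE.
have [_] := rate k def; have /iffLR/(_ diag) -> := coh1 k def.
by rewrite (mul1r N).
Qed.
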